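(* Let $(L|K,\nu)$ be a nontrivial separable purely wild extension of henselian valued fields with $\operatorname{char} K\nu=p>0$. Set $H:=\operatorname{Gal}(K^{\mathrm{sep}}|L)$ and $F:=(K^{\mathrm{sep}})^{[G_r,H]}$. Suppose that $L$ and $F$ are not linearly disjoint over $K$. Then $(K,\nu)$ does not admit a unique maximal purely wild extension if the residue field $K\nu$ is not Artin-Schreier closed.
   Context: Valuations are Krull valuations of arbitrary rank, written additively. $\nu K$ is the value group and $K\nu$ the residue field of $(K,\nu)$. $(K,\nu)$ is henselian if $\nu$ extends uniquely to the algebraic closure $K^{\mathrm{ac}}$; every algebraic extension of $K$ (inside $K^{\mathrm{ac}}$) carries this unique extension, again denoted $\nu$. $K^{\mathrm{sep}}$ is the separable closure of $K$ in $K^{\mathrm{ac}}$. The absolute ramification group of $(K,\nu)$ is $G_r:=\{\sigma\in\operatorname{Gal}(K^{\mathrm{sep}}|K)\mid \nu(\sigma x-x)>\nu x \text{ for all } x\in K^{\mathrm{sep}}\setminus\{0\}\}$. $[G_r,H]$ denotes the subgroup of $\operatorname{Gal}(K^{\mathrm{sep}}|K)$ generated by all commutators $ghg^{-1}h^{-1}$ with $g\in G_r$, $h\in H$, and $(K^{\mathrm{sep}})^{[G_r,H]}$ is its fixed field. For henselian $(K,\nu)$ with $\operatorname{char}K\nu=p>0$, an algebraic extension $(L|K,\nu)$ is purely wild if $\nu L/\nu K$ is a $p$-group and $L\nu|K\nu$ is purely inseparable. A maximal purely wild extension of $K$ is a purely wild extension inside $K^{\mathrm{ac}}$ not properly contained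 in another purely wild extension of $K$. ''$(K,\nu)$ does not admit a unique maximal purely wild extension'' means that there exist two maximal purely wild extensions of $(K,\nu)$ that are not isomorphic over $K$ by a valuation preserving isomorphism. A field $k$ of characteristic $p>0$ is Artin-Schreier closed if no polynomial $X^p-X-a\in k[X]$ is irreducible over $k$. *)

(* Defs.v *)
From HB Require Import structures.
From mathcomp Require Import all_boot all_order all_algebra.
From mathcomp Require Import generic_quotient ring_quotient separable.
From mathcomp Require Import boolp classical_sets functions.

Set Implicit Arguments.
Unset Strict Implicit.
Unset Printing Implicit Defensive.

Import Order.TTheory GRing.Theory Num.Theory.

Local Open Scope classical_set_scope.
Local Open Scope quotient_scope.
Local Open Scope ring_scope.

HB.mixin Record isOrderedAbGroup G of Num.POrderedZmodule G := {
  oag_le_total : total (<=%R : rel G);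
  oag_leD2l : forall z x y : G, x <= y -> z + x <= z + y
}.

#[short(type="orderedAbGroupType")]
HB.structure Definition OrderedAbGroup :=
  {G of Num.POrderedZmodule G & isOrderedAbGroup G}.

Section ExtendedValues.
Variable G : orderedAbGroupType.

(* [option G] is G with a top element: [None] is infinity. *)
Definition vle (a b : option G) : bool :=
  match a, b with
  | _, None => true
  | None, Some _ => false
  | Some x, Some y => x <= y
  end.

Definition vlt (a b : option G) : bool := ~~ vle b a.

Definition vadd (a b : option G) : option G :=
  if a is Some x then (if b is Some y then Some (x + y) else None) else None.

Lemma vlexx a : vle a a. Proof. by case: a => /=. Qed.

Lemma vle_trans b a c : vle a b -> vle b c -> vle a c.
Proof. by case: a; case: b; case: c => //= x y z; apply: le_trans. Qed.

Lemma vle_total a b : vle a b || vle b a.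
Proof. by case: a; case: b => //= x y; apply: oag_le_total. Qed.

Lemma vltW a b : vlt a b -> vle a b.
Proof. by rewrite /vlt => h; have := vle_total a b; rewrite (negbTE h) orbF. Qed.

Lemma vlt_le_trans b a c : vlt a b -> vle b c -> vlt a c.
Proof. by rewrite /vlt => h1 h2; apply: contra h1 => /(vle_trans h2). Qed.

Lemma leD2l (z x y : G) : (z + x <= z + y) = (x <= y).
Proof.
apply/idP/idP; last exact: oag_leD2l.
by move=> /(@oag_leD2l _ (- z)); rewrite !addKr.
Qed.

Lemma oag_ltNge (x y : G) : (x < y) = ~~ (y <= x).
Proof. by rewrite comparable_ltNge //; exact: oag_le_total. Qed.

Lemma leDD (x y z t : G) : x <= y -> z <= t -> x + z <= y + t.
Proof.
move=> xy zt; apply: (@le_trans _ _ (x + t)); first by rewrite leD2l.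
by rewrite ![_ + t]addrC leD2l.
Qed.

Lemma vadd_ge0 a b : vle (Some 0) a -> vle (Some 0) b -> vle (Some 0) (vadd a b).
Proof. by case: a; case: b => //= x y ? ?; rewrite -[0]addr0 leDD. Qed.

Lemma vadd_gt0 a b : vlt (Some 0) a -> vle (Some 0) b -> vlt (Some 0) (vadd a b).
Proof.
case: a; case: b => //= x y; rewrite /vlt /= -!oag_ltNge => y0 x0.
by apply: (lt_le_trans y0); rewrite -[leLHS]addr0 leD2l.
Qed.

End ExtendedValues.

Arguments vle : simpl never.
Arguments vlt : simpl never.

Record valuation (F : fieldType) (G : orderedAbGroupType) := Valuation {
  valuation_fun :> F -> option G;
  valuation_eqT : forall x, valuation_fun x = None <-> x = 0;
  valuationM : forall x y,
    valuation_fun (x * y) = vadd (valuation_fun x) (valuation_fun y);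
  (* v (x + y) >= min (v x) (v y) *)
  valuationD : forall x y,
    vle (valuation_fun x) (valuation_fun (x + y)) ||
    vle (valuation_fun y) (valuation_fun (x + y))
}.

Section ValuationTheory.
Variables (F : fieldType) (G : orderedAbGroupType) (v : valuation F G).

Lemma valuation0 : v 0 = None. Proof. exact/valuation_eqT. Qed.

Lemma valuation1 : v 1 = Some 0.
Proof.
have := valuationM v 1 1; rewrite mulr1; case e: (v 1) => [g|] /=.
  by move=> [/(congr1 (fun x => x - g))]; rewrite addrK subrr => ->.
by move/valuation_eqT: e => /eqP; rewrite oner_eq0.
Qed.

Lemma double_eq0 (g : G) : g + g = 0 -> g = 0.
Proof.
move=> gg; apply/eqP; rewrite eq_le; apply/andP; split.
  have /orP[//|g0] := oag_le_total g 0.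
  by rewrite -gg -[leLHS]addr0 leD2l.
have /orP[//|g0] := oag_le_total 0 g.
by rewrite -gg -[leRHS]addr0 leD2l.
Qed.

Lemma valuationN1 : v (-1) = Some 0.
Proof.
have := valuationM v (-1) (-1); rewrite mulrNN mulr1 valuation1.
by case: (v (-1)) => //= g [/esym/double_eq0 ->].
Qed.

Lemma valuationN x : v (- x) = v x.
Proof.
by rewrite -mulN1r valuationM valuationN1; case: (v x) => //= g; rewrite add0r.
Qed.

Lemma valuationD_ge c x y : vle c (v x) -> vle c (v y) -> vle c (v (x + y)).
Proof. by move=> cx cy; have /orP[] := valuationD v x y; exact: vle_trans. Qed.

Lemma valuationD_gt c x y : vlt c (v x) -> vlt c (v y) -> vlt c (v (x + y)).
Proof. by move=> cx cy; have /orP[] := valuationD v x y; exact: vlt_le_trans. Qed.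

Lemma valuationV x : v x = Some 0 -> v x^-1 = Some 0.
Proof.
move=> vx; have x0 : x != 0 by apply/eqP=> /(valuation_eqT v); rewrite vx.
have := valuationM v x x^-1; rewrite divff // valuation1 vx.
by case: (v x^-1) => //= g; rewrite add0r.
Qed.

Definition valring_pred : {pred F} := [pred x | vle (Some 0) (v x)].

Lemma valring_closed : subring_closed valring_pred.
Proof.
split=> [|x y|x y]; rewrite !inE /= ?valuation1 ?vlexx // => x0 y0.
  by apply: valuationD_ge => //; rewrite valuationN.
by rewrite valuationM vadd_ge0.
Qed.

HB.instance Definition _ := GRing.isSubringClosed.Build F valring_pred valring_closed.

Record valring := ValRing {
  valring_val : F;
  valring_valP : valring_val \in valring_pred }.

HB.instance Definition _ := [isSub for valring_val].
HB.instance Definition _ := [Choice of valring by <:].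
HB.instance Definition _ := [SubChoice_isSubComNzRing of valring by <:].

Definition maxideal : {pred valring} := [pred x | vlt (Some 0) (v (val x))].

Lemma maxideal_closed : idealr_closed maxideal.
Proof.
split.
- by rewrite inE /= valuation0.
- by rewrite inE /= valuation1 /vlt negbK vlexx.
move=> a x y; rewrite !inE /= => x0 y0.
apply: valuationD_gt => //; rewrite mulrC valuationM vadd_gt0 //.
exact: valring_valP a.
Qed.

HB.instance Definition _ := isIdealr.Build valring maxideal maxideal_closed.

Definition residue_field := {ideal_quot maxideal}.

HB.instance Definition _ := GRing.ComNzRing.on residue_field.

Definition residue (x : valring) : residue_field := \pi_residue_field x.

Lemma residue0 : residue 0 = 0. Proof. exact: rmorph0. Qed.
Lemma residue1 : residue 1 = 1. Proof. exact: rmorph1. Qed.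
Lemma residueD : {morph residue : x y / x + y}. Proof. exact: rmorphD. Qed.
Lemma residueM : {morph residue : x y / x * y}. Proof. exact: rmorphM. Qed.

Lemma residue_eq x y : (residue x == residue y) = (x - y \in maxideal).
Proof. by rewrite /residue Quotient.idealrBE. Qed.

Lemma valuation_unit (x : valring) : x \notin maxideal -> v (val x) = Some 0.
Proof.
rewrite inE negbK; have := valring_valP x; rewrite inE /=.
case: (v _) => //= g; rewrite /vle => g0 g1; congr Some.
by apply/eqP; rewrite eq_le g0 g1.
Qed.

Definition valring_inv (x : valring) : valring := insubd 0 (val x)^-1.

Definition residue_inv (a : residue_field) : residue_field :=
  if a == 0 then 0 else residue (valring_inv (repr a)).

Lemma residue_mulVf a : a != 0 -> residue_inv a * a = 1.
Proof.
move=> a0; rewrite /residue_inv (negbTE a0).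
have ea : a = residue (repr a) by rewrite /residue reprK.
have ux : v (val (repr a)) = Some 0.
  apply: valuation_unit; apply: contra a0 => h.
  by rewrite ea -residue0 residue_eq subr0.
have x0 : val (repr a) != 0 by apply/eqP=> /(valuation_eqT v); rewrite ux.
rewrite {2}ea -residueM -residue1; congr residue.
apply: val_inj.
have -> : val (valring_inv (repr a) * repr a)
  = val (valring_inv (repr a)) * val (repr a) by [].
by rewrite /valring_inv insubdK ?mulVf // inE /= (valuationV ux) vlexx.
Qed.

Lemma residue_inv0 : residue_inv 0 = 0.
Proof. by rewrite /residue_inv eqxx. Qed.

HB.instance Definition _ :=
  GRing.ComNzRing_isField.Build residue_field residue_mulVf residue_inv0.

(* v M *)
Definition value_group (M : set F) : set G :=
  [set g | exists2 x, M x & v x = Some g].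

(* M v, as a subset of F v *)
Definition residue_subfield (M : set F) : set residue_field :=
  [set residue x | x in [set x | M (val x)]].

End ValuationTheory.

Arguments residue_subfield {F G} v M.

Section Subfields.
Variable E : fieldType.
Implicit Types (k M N : set E) (q : {poly E}).

Definition is_subfield M : Prop := divring_closed (mem M).

(* For a subfield k of E, divisibility in E[X] between polynomials over k is
   divisibility in k[X]. *)
Definition irreducible_over k q : Prop :=
  [/\ q \is a polyOver (mem k), (1 < size q)%N &
      forall r, r \is a polyOver (mem k) -> size r != 1 -> r %| q -> r %= q].

Definition algebraic_over k (x : E) : Prop :=
  exists q, [/\ q \is a polyOver (mem k), q != 0 & root q x].

(* The irreducible polynomial of x over k is separable. *)
Definition separable_over k (x : E) : Prop :=
  exists q, [/\ irreducible_over k q, root q x & separable_poly q].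

Definition separable_closure k : set E := [set x | separable_over k x].

Definition artin_schreier_closed (p : nat) k : Prop :=
  forall a, k a -> ~ irreducible_over k ('X^p - 'X - a%:P).

Definition linearly_free k (n : nat) (x : 'I_n -> E) : Prop :=
  forall c : 'I_n -> E, (forall i, k (c i)) ->
    \sum_(i < n) c i * x i = 0 -> forall i, c i = 0.

Definition linearly_disjoint k M N : Prop :=
  forall (n : nat) (x : 'I_n -> E), (forall i, M (x i)) ->
    linearly_free k x -> linearly_free N x.

Definition purely_inseparable (p : nat) k M : Prop :=
  forall x, M x -> exists n, k (x ^+ (p ^ n)).

(* Field isomorphism of M onto N over k; only the values of f on M matter. *)
Definition iso_over k M N (f : E -> E) : Prop :=
  [/\ set_bij M N f,
      forall x y, M x -> M y -> f (x + y) = f x + f y,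
      forall x y, M x -> M y -> f (x * y) = f x * f y &
      forall x, k x -> f x = x].

(* Gal(M|k). An automorphism of M is extended by the identity outside M, so
   that equality in [gal M k] is equality of automorphisms of M. *)
Record gal M k := Gal {
  gal_fun :> E -> E;
  gal_iso : iso_over k M M gal_fun;
  gal_out : forall x, ~ M x -> gal_fun x = x }.

End Subfields.

Section GaloisGroup.
Variables (E : fieldType) (M k : set E).
Local Notation gal := (gal M k).
Implicit Types s t : gal.

HB.instance Definition _ := gen_eqMixin gal.
HB.instance Definition _ := gen_choiceMixin gal.

Lemma galP s t : (forall x, s x = t x) -> s = t.
Proof.
case: s t => [f fi fo] [g gi go] /= /funext fg.
by subst g; rewrite (Prop_irrelevance fi gi) (Prop_irrelevance fo go).
Qed.

Lemma gal_stable s x : M x -> M (s x).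
Proof. by case: (gal_iso s) => -[st _ _] _ _ _; exact: st. Qed.

Lemma gal_stableV s x : M (s x) -> M x.
Proof. by move=> msx; apply: contrapT => nx; move: (msx); rewrite gal_out. Qed.

Lemma gal_inj s x y : s x = s y -> x = y.
Proof.
move=> e; have [mx|nx] := pselect (M x).
  have my : M y by apply: (@gal_stableV s); rewrite -e; exact: gal_stable.
  by case: (gal_iso s) => -[_ inj _] _ _ _; apply: inj => //; rewrite inE.
have ny : ~ M y.
  by move=> my; apply: nx; apply: (@gal_stableV s); rewrite e; exact: gal_stable.
by move: e; rewrite !gal_out.
Qed.

Lemma gal_surj s y : exists x, s x = y.
Proof.
have [my|ny] := pselect (M y); last by exists y; rewrite gal_out.
by case: (gal_iso s) => -[_ _ sur] _ _ _; have [x _ <-] := sur _ my; exists x.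
Qed.

Definition gal_inv_fun s (y : E) : E := sval (cid (gal_surj s y)).

Lemma gal_invK s : cancel (gal_inv_fun s) s.
Proof. by move=> y; rewrite /gal_inv_fun; case: cid. Qed.

Lemma galK s : cancel s (gal_inv_fun s).
Proof. by move=> x; apply: (@gal_inj s); rewrite gal_invK. Qed.

Lemma gal_inv_stable s y : M y -> M (gal_inv_fun s y).
Proof. by move=> my; apply: (@gal_stableV s); rewrite gal_invK. Qed.

Fact gal1_iso : iso_over k M M idfun.
Proof.
by split=> //; split=> // y my; exists y.
Qed.
Definition gal1 : gal := Gal gal1_iso (fun _ _ => erefl).

Fact gal_mul_iso s t : iso_over k M M (s \o t).
Proof.
case: (gal_iso s) => _ sD sM sk; case: (gal_iso t) => _ tD tM tk; split.
- split=> [x mx|x y _ _ /gal_inj/gal_inj //|y my].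
    by do 2 apply: gal_stable.
  exists (gal_inv_fun t (gal_inv_fun s y)); first by do 2 apply: gal_inv_stable.
  by rewrite /= !gal_invK.
- by move=> x y mx my /=; rewrite tD // sD //; exact: gal_stable.
- by move=> x y mx my /=; rewrite tM // sM //; exact: gal_stable.
- by move=> x kx /=; rewrite tk // sk.
Qed.
Fact gal_mul_out s t x : ~ M x -> (s \o t) x = x.
Proof. by move=> nx /=; rewrite !gal_out. Qed.
Definition gal_mul s t : gal := Gal (gal_mul_iso s t) (@gal_mul_out s t).

Fact gal_inv_iso s : iso_over k M M (gal_inv_fun s).
Proof.
case: (gal_iso s) => _ sD sM sk; split.
- split=> [x|x y _ _ /(congr1 s)|y my]; first exact: gal_inv_stable.
    by rewrite !gal_invK.
  by exists (s y); rewrite ?galK //; exact: gal_stable.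
- move=> x y mx my; apply: (@gal_inj s).
  by rewrite sD ?gal_invK //; exact: gal_inv_stable.
- move=> x y mx my; apply: (@gal_inj s).
  by rewrite sM ?gal_invK //; exact: gal_inv_stable.
- by move=> x kx; rewrite -{1}(sk x kx) galK.
Qed.
Fact gal_inv_out s x : ~ M x -> gal_inv_fun s x = x.
Proof. by move=> nx; rewrite -{1}(gal_out s nx) galK. Qed.
Definition gal_inv s : gal := Gal (gal_inv_iso s) (@gal_inv_out s).

Fact gal_mulA : associative gal_mul.
Proof. by move=> s t u; exact: galP. Qed.
Fact gal_mul1s : left_id gal1 gal_mul.
Proof. by move=> s; exact: galP. Qed.
Fact gal_muls1 : right_id gal1 gal_mul.
Proof. by move=> s; exact: galP. Qed.
Fact gal_mulVs : left_inverse gal1 gal_inv gal_mul.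
Proof. by move=> s; apply: galP => x /=; rewrite galK. Qed.
Fact gal_mulsV : right_inverse gal1 gal_inv gal_mul.
Proof. by move=> s; apply: galP => x /=; rewrite gal_invK. Qed.

HB.instance Definition _ :=
  isGroup.Build gal gal_mulA gal_mul1s gal_muls1 gal_mulVs gal_mulsV.

(* Gal(M|N) as a subgroup of Gal(M|k), for k <= N <= M *)
Definition gal_over (N : set E) : set gal :=
  [set s : gal | forall x, N x -> s x = x].

Definition fixed_field (A : set gal) : set E :=
  [set x | M x /\ forall s : gal, A s -> s x = x].

End GaloisGroup.

Arguments gal_over {E} M k N.

Definition commutator_subgroup (gT : groupType) (A B : set gT) : set gT :=
  smallest (fun S : set gT => group_closed (mem S))
    [set (g * h * g^-1 * h^-1)%g | g in A & h in B].

Section ValuedFields.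
Variables (p : nat) (F : fieldType) (G : orderedAbGroupType).
Variable v : valuation F G.
Implicit Types K M W : set F.

Definition equivalent_on (G' : orderedAbGroupType) M (w : valuation F G') : Prop :=
  forall x y, M x -> M y -> vle (v x) (v y) <-> vle (w x) (w y).

(* The restriction of v to M extends uniquely to F, up to equivalence of
   valuations; used when F is an algebraic closure of M. *)
Definition henselian M : Prop :=
  forall (G' : orderedAbGroupType) (w : valuation F G'),
    equivalent_on M w -> equivalent_on setT w.

(* v M / v K is a p-group and M v | K v is purely inseparable. *)
Definition purely_wild K M : Prop :=
  [/\ is_subfield M, K `<=` M,
      forall g, value_group v M g -> exists n, value_group v K (g *+ (p ^ n)) &
      purely_inseparable p (residue_subfield v K) (residue_subfield v M)].

Definition maximal_purely_wild K W : Prop :=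
  purely_wild K W /\ forall W', purely_wild K W' -> W `<=` W' -> W' = W.

Definition valued_isomorphic K M N : Prop :=
  exists f : F -> F, iso_over K M N f /\ forall x, M x -> v (f x) = v x.

(* The absolute ramification group of (K, v) *)
Definition ramification_group K : set (gal (separable_closure K) K) :=
  [set s : gal (separable_closure K) K |
    forall x, separable_closure K x -> x != 0 -> vlt (v x) (v (s x - x))].

End ValuedFields.

Arguments ramification_group {F G} v K.

(* Main.v *)
Require Import Defs.
From HB Require Import structures.
From mathcomp Require Import all_boot all_order all_algebra separable ring.
From mathcomp Require Import boolp classical_sets functions.

Set Implicit Arguments.
Unset Strict Implicit.
Unset Printing Implicit Defensive.

Import Order.TTheory GRing.Theory Num.Theory.

Local Open Scope classical_set_scope.
Local Open Scope ring_scope.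

(** Write E for the algebraic closure of K, and A for the group of all automorphisms of E
    over K. Say that x and y have the same leading term, [rv x y], if y = x (1 + u) for
    some u of positive value. As K is henselian, A acts on leading terms. An automorphism
    is called ramified if it fixes all leading terms; its restriction to the separable
    closure is then in the ramification group. The proof rests on two facts.

    (1) An extension M of K is purely wild if and only if all elements of A fix the
    leading terms of the elements of M ([purely_wildP], [wild_element_rv],
    [wild_element_of_rv]).

    (2) If M contains K and s in A fixes the leading terms of the elements of M, then s
    agrees on M with a ramified automorphism ([ramified_extension]). So for M purely wild,
    every element of A is the product of a ramified automorphism and an automorphism
    over M.

    By (1), the fixed field of a set S of automorphisms is purely wild as soon as every
    element of A can be brought into S by composition with a ramified one.

    If L and F are not linearly disjoint, a shortest linear relation produces some c in
    both L and F but not in K. Since commutators of ramified automorphisms with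
    automorphisms over L fix c, the images of c under ramified automorphisms lie in L, and
    by (2) these are all the conjugates of c ([normal_element]). Counting with leading
    terms gives an automorphism g with g^p c = c and g c <> c ([order_p_aut]).

    Since the residue field of K is not Artin-Schreier closed, there is an unramified
    cyclic extension of degree p, generated by a root t_0 of X^p - X - k with conjugates
    t_0, ..., t_(p-1). Let M be the fixed field of all automorphisms which shift the t_i
    and the g^i c by the same amount. Ramified automorphisms fix the t_i but act on the
    g^i c like arbitrary automorphisms, so M is purely wild by the remark above. A purely
    wild W cannot contain both M and the conjugates of c: otherwise it contains the sums
    of the g^i(c) t_i^j over i, for all j, and an automorphism over W which shifts the t_i
    shows that g c = c ([incompatible_purely_wild]).

    Let W1 and W2 be maximal purely wild extensions containing L and M. An isomorphism of W1
    with W2 over K extends to an element of A, so it maps the set of conjugates of c, which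
    is contained in L, onto itself; but W2 does not contain this set. *)

(** * Subrings of a commutative ring *)
Section Subrings.
Variable R : comNzRingType.
Implicit Type S : set R.

(** The proof is an argument so that the ring structure of the predicate can be inferred
    from it; the closure lemmas for ring predicates then apply to sets. *)
Definition set_pred S (_ : subring_closed (mem S)) : {pred R} := mem S.

HB.instance Definition _ S (S_ring : subring_closed (mem S)) :=
  GRing.isSubringClosed.Build R (set_pred S_ring) S_ring.

Lemma subringP S : [/\ S 1, forall x y, S x -> S y -> S (x - y) &
  forall x y, S x -> S y -> S (x * y)] -> subring_closed (mem S).
Proof.
by case=> S1 SB SM; split=> [|x y|x y]; rewrite !in_setE //; [exact: SB|exact: SM].
Qed.

Section Closure.
Variables (S : set R) (S_ring : subring_closed (mem S)).
Let P : subringClosed R := set_pred S_ring.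
Let inP x : x \in P <-> S x.
Proof. by split=> h; [apply/set_mem|apply/mem_set]. Qed.
Let polyOverE : polyOver (mem S) = polyOver P. Proof. by []. Qed.

Lemma subring1 : S 1. Proof. by apply/inP; rewrite rpred1. Qed.

Lemma subring0 : S 0. Proof. by apply/inP; rewrite rpred0. Qed.

Lemma subringD x y : S x -> S y -> S (x + y).
Proof. by move=> /inP xP /inP yP; apply/inP; rewrite rpredD. Qed.

Lemma subringN x : S x -> S (- x).
Proof. by move=> /inP xP; apply/inP; rewrite rpredN. Qed.

Lemma subringB x y : S x -> S y -> S (x - y).
Proof. by move=> /inP xP /inP yP; apply/inP; rewrite rpredB. Qed.

Lemma subringM x y : S x -> S y -> S (x * y).
Proof. by move=> /inP xP /inP yP; apply/inP; rewrite rpredM. Qed.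

Lemma subringX x n : S x -> S (x ^+ n).
Proof. by move=> /inP xP; apply/inP; rewrite rpredX. Qed.

Lemma subring_nat n : S n%:R.
Proof. by apply/inP; rewrite rpred_nat. Qed.

Lemma subring_sum I (r : seq I) (Q : pred I) (F : I -> R) :
  (forall i, Q i -> S (F i)) -> S (\sum_(i <- r | Q i) F i).
Proof. by move=> SF; apply/inP; apply: rpred_sum => i /SF /inP. Qed.

Lemma polyOver_setP (p : {poly R}) :
  (forall i, S p`_i) <-> p \is a polyOver (mem S).
Proof.
rewrite polyOverE; split=> [Sp|Sp i]; first by apply/polyOverP => i; apply/inP.
by apply/inP; exact: (polyOverP Sp).
Qed.

Lemma subring_horner (p : {poly R}) x : p \is a polyOver (mem S) -> S x -> S p.[x].
Proof. by rewrite polyOverE => pS /inP xP; apply/inP; rewrite rpred_horner. Qed.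

Lemma monic_division (F p : {poly R}) : F \is monic ->
  F \is a polyOver (mem S) -> p \is a polyOver (mem S) ->
  exists Q r, [/\ Q \is a polyOver (mem S), r \is a polyOver (mem S),
    p = Q * F + r & (size r < size F)%N].
Proof.
rewrite polyOverE => Fm FS.
elim/poly_ind: p => [_|p c IHp pcS].
  by exists 0, 0; rewrite !rpred0 mul0r addr0 size_poly0 lt0n size_poly_eq0 monic_neq0.
have [cS pS] : c%:P \is a polyOver P /\ p \is a polyOver P.
  move/polyOverP: pcS => pcS; split.
    by rewrite polyOverC; have := pcS 0%N; rewrite coefD coefMX coefC add0r.
  by apply/polyOverP => i; have := pcS i.+1; rewrite coefD coefMX coefC addr0.
have [Q [r [QS rS pE sr]]] := IHp pS.
(* r1 has degree at most that of F; subtracting a F lowers it. *)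
pose r1 := r * 'X + c%:P; pose a := r1`_(size F).-1.
have r1S : r1 \is a polyOver P by rewrite rpredD // rpredM // polyOverX.
have aS : a%:P \is a polyOver P by rewrite polyOverC; exact: (polyOverP r1S).
exists (Q * 'X + a%:P), (r1 - a%:P * F); split.
- by rewrite rpredD // rpredM // polyOverX.
- by rewrite rpredB // rpredM.
- by rewrite mulrDl addrACA subrr addr0 pE mulrDl -!addrA mulrAC.
have F0 : (0 < size F)%N by rewrite lt0n size_poly_eq0 monic_neq0.
rewrite -(prednK F0) ltnS; apply/leq_sizeP => j; rewrite leq_eqVlt.
rewrite coefB coefCM => /predU1P[<-|lj].
  by rewrite -/(lead_coef F) (monicP Fm) mulr1 subrr.
rewrite [F`_j]nth_default; last by rewrite -(prednK F0).
rewrite mulr0 subr0 coefD coefMX coefC.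
case: j lj => // j lj /=; rewrite addr0 nth_default //.
by rewrite -ltnS; apply: (leq_trans sr); rewrite -(prednK F0).
Qed.

Definition adjoin (z : R) : set R := [set p.[z] | p in [set p | p \is a polyOver (mem S)]].

Lemma adjoin_ring z : subring_closed (mem (adjoin z)).
Proof.
apply: subringP; split.
- by exists 1; rewrite ?hornerC //= polyOverE rpred1.
- move=> _ _ [p pS <-] [q qS <-]; exists (p - q); last by rewrite hornerD hornerN.
  by move: pS qS; rewrite /= polyOverE => pS qS; rewrite rpredB.
- move=> _ _ [p pS <-] [q qS <-]; exists (p * q); last by rewrite hornerM.
  by move: pS qS; rewrite /= polyOverE => pS qS; rewrite rpredM.
Qed.

Lemma sub_adjoin z : S `<=` adjoin z.
Proof.
move=> x Sx; exists x%:P; rewrite ?hornerC //=.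
by rewrite polyOverE polyOverC; apply/inP.
Qed.

Lemma adjoin_gen z : adjoin z z.
Proof. by exists 'X; rewrite ?hornerX //= polyOverE polyOverX. Qed.

Lemma adjoinE (F : {poly R}) z x : F \is monic -> F \is a polyOver (mem S) ->
  F.[z] = 0 -> adjoin z x ->
  exists2 r, r \is a polyOver (mem S) /\ (size r < size F)%N & x = r.[z].
Proof.
move=> Fm FS Fz [p pS <-]; have [Q [r [QS rS -> sr]]] := monic_division Fm FS pS.
by exists r => //; rewrite hornerD hornerM Fz mulr0 add0r.
Qed.

End Closure.

Lemma subring_bigcup (C : set (set R)) S0 : subring_closed (mem S0) -> C S0 ->
  (forall S, C S -> subring_closed (mem S)) -> total_on C subset ->
  subring_closed (mem (\bigcup_(S in C) S)).
Proof.
move=> S0r CS0 Cr Ct.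
have join x y : (\bigcup_(S in C) S) x -> (\bigcup_(S in C) S) y ->
    exists S, [/\ C S, S x & S y].
  move=> [S CS Sx] [T CT Ty]; have [ST|TS] := Ct _ _ CS CT.
    by exists T; split=> //; exact: ST.
  by exists S; split=> //; exact: TS.
apply: subringP; split; first by exists S0 => //; exact: subring1.
  move=> x y /join xy /xy[S [CS Sx Sy]]; exists S => //.
  exact: (subringB (Cr _ CS)).
move=> x y /join xy /xy[S [CS Sx Sy]]; exists S => //.
exact: (subringM (Cr _ CS)).
Qed.

(** Zorn's lemma in the one form that is used here: a condition on single elements is
    inherited by unions of chains. It yields maximal extensions of isomorphisms
    (subrings of E x E) as well as maximal purely wild extensions (subrings of E). *)
Lemma maximal_subring (rho S0 : set R) : subring_closed (mem S0) -> S0 `<=` rho ->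
  exists S, [/\ subring_closed (mem S), S0 `<=` S, S `<=` rho &
    forall T, subring_closed (mem T) -> S `<=` T -> T `<=` rho -> T `<=` S].
Proof.
move=> S0r S0rho.
(* Zorn's lemma is also applied to the empty chain, hence the union with S0. *)
pose D (A : set R) :=
  [/\ subring_closed (mem (A `|` S0)) & A `|` S0 `<=` rho].
have chain (C : set (set R)) : C `<=` D -> total_on C subset -> D (\bigcup_(A in C) A).
  move=> CD Ct; split; last first.
    move=> x [[A CA Ax]|]; last exact: S0rho.
    by have [_] := CD _ CA; apply; left.
  pose C' := [set A `|` S0 | A in C `|` [set set0]].
  have -> : \bigcup_(A in C) A `|` S0 = \bigcup_(A in C') A.
    apply/seteqP; split=> x.
      case=> [[A CA Ax]|S0x].
        by exists (A `|` S0); [exists A => //; left|left].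
      by exists (set0 `|` S0); [exists set0 => //; right|right].
    case=> _ [A [CA|->] <-]; last by case=> // S0x; right.
    by case=> [Ax|S0x]; [left; exists A|right].
  apply: (@subring_bigcup _ (set0 `|` S0)).
  - by rewrite set0U.
  - by exists set0 => //; right.
  - by move=> _ [A [/CD DA|->] <-]; [case: DA|rewrite set0U].
  - move=> _ _ [A CA <-] [B CB <-].
    have [AB|BA] : A `<=` B \/ B `<=` A.
      case: CA => [CA|->]; last by left.
      by case: CB => [CB|->]; [exact: Ct|right].
    + by left; exact: setSU.
    + by right; exact: setSU.
have [A [[Ar Arho] Amax]] := Zorn_bigcup chain.
exists (A `|` S0); split; [exact: Ar|by move=> x S0x; right|exact: Arho|].
move=> T Tr AT Trho x Tx; apply: contrapT => nAx.
have TS0 : T `|` S0 = T.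
  by apply/seteqP; split=> y; [case=> // S0y; apply: AT; right|left].
apply: (Amax T); last by split; rewrite TS0.
by split=> [y Ay|]; [apply: AT; left|move=> /(_ _ Tx) Ax; apply: nAx; left].
Qed.

End Subrings.

(** * Isomorphisms between subfields, as subrings of the square *)
Section Subfields.
Variable E : fieldType.
Implicit Type M : set E.

Lemma subfield_subring M : is_subfield M -> subring_closed (mem M).
Proof. exact: GRing.divring_closedBM. Qed.

Lemma subfieldV M x : is_subfield M -> M x -> M x^-1.
Proof.
move=> [M1 _ MV] Mx; apply: set_mem; rewrite -div1r; apply: MV => //.
exact: mem_set.
Qed.

End Subfields.

Section Graphs.
Variables (E : closedFieldType) (K : set E).
Hypothesis K_field : is_subfield K.
Hypothesis K_alg : forall x : E, algebraic_over K x.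
Implicit Types (M : set E) (S T : set (E * E)).

Let K_ring := subfield_subring K_field.

(** The inverse of an algebraic element is a polynomial in it; hence rings between
    K and E are fields, and subrings of E x E are closed under inverses. *)
Lemma inverse_poly x : x != 0 ->
  exists2 q : {poly E}, q \is a polyOver (mem K) & x * q.[x] = 1.
Proof.
move=> x0; have [p [pK p0 px]] := K_alg x.
elim/poly_ind: p => [|p c IHp] in pK p0 px *; first by rewrite eqxx in p0.
have /(polyOver_setP K_ring) pK' := pK.
have cK : K c by have := pK' 0%N; rewrite coefD coefMX coefC add0r.
have {pK'} pK' : p \is a polyOver (mem K).
  apply/(polyOver_setP K_ring) => i.
  by have := pK' i.+1; rewrite coefD coefMX coefC addr0.
have : p.[x] * x + c = 0 by move/rootP: px; rewrite hornerMXaddC.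
have [c0|c0] := eqVneq c 0.
  rewrite c0 addr0 => /eqP; rewrite mulf_eq0 (negbTE x0) orbF => px'.
  apply: IHp => //; apply: contraNneq p0 => ->; by rewrite c0 mul0r addr0.
move/eqP; rewrite addr_eq0 => /eqP e.
exists ((- c^-1)%:P * p).
  apply/(polyOver_setP K_ring) => i; rewrite coefCM.
  apply: (subringM K_ring); last by move/(polyOver_setP K_ring): pK'; exact.
  by apply: (subringN K_ring); exact: subfieldV.
by rewrite hornerCM mulrCA [x * _]mulrC e mulNr mulrN opprK mulVf.
Qed.

Lemma subring_subfield M : subring_closed (mem M) -> K `<=` M -> is_subfield M.
Proof.
move=> Mr KM; case: (Mr) => M1 MB _; split=> // x y xM yM.
apply/mem_set; apply: (subringM Mr); first exact: set_mem.
have [->|/inverse_poly[q qK /eqP]] := eqVneq y 0.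
  by rewrite invr0; exact: (subring0 Mr).
have [->|y0 /eqP e] := eqVneq y 0; first by rewrite mul0r eq_sym oner_eq0.
have -> : y^-1 = q.[y] by apply: (mulfI y0); rewrite e divff.
apply: (subring_horner Mr); last exact: set_mem.
apply/(polyOver_setP Mr) => i; apply: KM; move: i.
exact/(polyOver_setP K_ring).
Qed.

(** Minimal polynomials are needed with coefficients in a subfield of E and with
    coefficients in a subring A of E x E, evaluated through the first projection;
    [phi] is the identity in the first case, the projection in the second. *)
Section MinimalPolynomial.
Variables (R : comNzRingType) (phi : {rmorphism R -> E}) (A : set R).
Hypothesis A_ring : subring_closed (mem A).
Hypothesis A_inv : forall x, A x -> x != 0 -> exists2 y, A y & y * x = 1.

Lemma minimal_polynomial y :
  (exists r : {poly R}, [/\ r \is a polyOver (mem A), r != 0 & root (map_poly phi r) y]) ->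
  exists F : {poly R}, [/\ F \is monic, F \is a polyOver (mem A),
    root (map_poly phi F) y &
    forall r, r \is a polyOver (mem A) -> (size r < size F)%N ->
      root (map_poly phi r) y -> r = 0].
Proof.
pose D n := `[< exists r : {poly R}, [/\ r \is a polyOver (mem A), r != 0,
  root (map_poly phi r) y & size r = n] >].
move=> [r0 [r0A r00 r0y]].
have exD : exists n, D n by exists (size r0); apply/asboolP; exists r0.
have [n /asboolP[r [rA rn0 ry sr]] nmin] := ex_minnP exD.
have rA' := (polyOver_setP A_ring r).2 rA.
have [c Ac cE] : exists2 c, A c & c * lead_coef r = 1.
  by apply: A_inv; [exact: rA'|rewrite lead_coef_eq0].
have lc : lead_coef c%:P * lead_coef r != 0 by rewrite lead_coefC cE oner_neq0.
exists (c%:P * r); split.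
- by rewrite monicE lead_coef_proper_mul // lead_coefC cE.
- apply/(polyOver_setP A_ring) => i; rewrite coefCM.
  exact: (subringM A_ring).
- by rewrite rmorphM rootM ry orbT.
move=> q qA; rewrite (size_proper_mul lc) size_polyC.
have -> : c != 0 by apply: contraNneq lc => ->; rewrite lead_coefC mul0r.
rewrite /= => sq qy; apply/eqP; apply: contraT => q0.
have /nmin : D (size q) by apply/asboolP; exists q.
by rewrite leqNgt -sr sq.
Qed.

End MinimalPolynomial.

Definition diag M : set (E * E) := [set (x, x) | x in M].

(** The graph of a field homomorphism over K between two subfields of E, as a subring of
    E x E: for a subring, being the graph of a function is a condition at zero only.
    Unions of chains and adjunctions are then operations on sets. *)
Definition graph S := [/\ subring_closed (mem S), diag K `<=` S &
  forall z, S z -> z.1 = 0 -> z.2 = 0].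

Section GraphTheory.
Variable S : set (E * E).
Hypothesis S_graph : graph S.
Let S_ring : subring_closed (mem S). Proof. by case: S_graph. Qed.
Let KS : diag K `<=` S. Proof. by case: S_graph. Qed.
Let S0 : forall z, S z -> z.1 = 0 -> z.2 = 0. Proof. by case: S_graph. Qed.

Lemma graph_poly (q : {poly E}) z : q \is a polyOver (mem K) -> S z ->
  S (q.[z.1], q.[z.2]).
Proof.
move=> /(polyOver_setP K_ring) qK Sz.
have -> : (q.[z.1], q.[z.2]) = \sum_(i < size q) (q`_i, q`_i) * z ^+ i.
  rewrite [RHS]surjective_pairing !horner_coef.
  rewrite !(rmorph_sum fst) !(rmorph_sum snd); congr (_, _);
    by apply: eq_bigr => i _; rewrite !rmorphM !rmorphXn.
apply: (subring_sum S_ring) => i _; apply: (subringM S_ring).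
  by apply: KS; exists q`_i.
exact: (subringX S_ring).
Qed.

Lemma graph_fun x y y' : S (x, y) -> S (x, y') -> y = y'.
Proof.
move=> Sy Sy'; have := S0 (subringB S_ring Sy Sy'); rewrite /= subrr => /(_ erefl).
by move/eqP; rewrite subr_eq0 => /eqP.
Qed.

Lemma graph_inv z : S z -> z != 0 -> exists2 w, S w & w * z = 1.
Proof.
move=> Sz z0; have z10 : z.1 != 0.
  apply: contraNneq z0 => z1; have z2 := S0 Sz z1.
  by rewrite [z]surjective_pairing z1 z2.
have [q qK qz] := inverse_poly z10; have Sq := graph_poly qK Sz.
exists (q.[z.1], q.[z.2]) => //.
have := S0 (subringB S_ring (subringM S_ring Sq Sz) (subring1 S_ring)).
rewrite /= [_ * z.1]mulrC qz subrr => /(_ erefl)/eqP.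
rewrite subr_eq0 => /eqP e; rewrite [LHS]surjective_pairing /= e.
by rewrite mulrC qz.
Qed.

Lemma graph_snd0 z : S z -> z.2 = 0 -> z.1 = 0.
Proof.
move=> Sz z2; have [->//|z0] := eqVneq z 0.
have [w _ /(congr1 snd) /=] := graph_inv Sz z0.
by rewrite z2 mulr0 => /eqP; rewrite eq_sym oner_eq0.
Qed.

Lemma graph_swap : graph [set z | S (z.2, z.1)].
Proof.
split.
- apply: subringP; split=> [|x y /= Sx Sy|x y /= Sx Sy].
  + exact: (subring1 S_ring).
  + exact: (subringB S_ring Sx Sy).
  + exact: (subringM S_ring Sx Sy).
- by move=> _ [x Kx <-]; apply: KS; exists x.
- by move=> z /= /graph_snd0 h; exact: h.
Qed.

(** Both components of the minimal polynomial of y over S are recorded at once: the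
    first is the minimal polynomial of y over the domain, the second its image. *)
Lemma graph_minimal_polynomial y : exists F : {poly E * E},
  [/\ F \is monic, F \is a polyOver (mem S), root (map_poly fst F) y &
  forall r, r \is a polyOver (mem S) -> (size r < size F)%N ->
    root (map_poly fst r) y -> r = 0].
Proof.
apply: (minimal_polynomial (phi := fst) S_ring graph_inv).
have [q [qK q0 qy]] := K_alg y.
pose r : {poly E * E} := \poly_(i < size q) (q`_i, q`_i).
have r1 : map_poly fst r = q.
  apply/polyP => i; rewrite coef_map coef_poly; case: ltnP => //= h.
  by rewrite nth_default.
exists r; split; last by rewrite r1.
  apply/(polyOver_setP S_ring) => i; rewrite coef_poly; case: ifP => _.
    apply: KS; exists q`_i => //; move: i; exact/(polyOver_setP K_ring).
  exact: (subring0 S_ring).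
by apply: contraNneq q0 => r0; rewrite -r1 r0 rmorph0.
Qed.

Lemma root_map_pair (F : {poly E * E}) y y' : root (map_poly fst F) y ->
  root (map_poly snd F) y' -> F.[(y, y')] = 0.
Proof.
move=> /rootP Fy /rootP Fy'; rewrite [LHS]surjective_pairing.
by rewrite -(horner_map fst) -(horner_map snd) /= Fy Fy'.
Qed.

(** Extending a homomorphism to a simple extension: y may be sent to any root y' of the
    image of its minimal polynomial. *)
Lemma graph_adjoin (F : {poly E * E}) y y' : F \is monic ->
  F \is a polyOver (mem S) -> root (map_poly fst F) y ->
  (forall r, r \is a polyOver (mem S) -> (size r < size F)%N ->
    root (map_poly fst r) y -> r = 0) ->
  root (map_poly snd F) y' -> graph (adjoin S (y, y')).
Proof.
move=> Fm FS Fy Fmin Fy'; split; first exact: (adjoin_ring S_ring).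
  by apply: (subset_trans KS); exact: (sub_adjoin S_ring).
move=> z; have Fyy' := root_map_pair Fy Fy'.
move=> /(adjoinE S_ring Fm FS Fyy')[r [rS sr] ->] r1.
rewrite (Fmin r rS sr) ?horner0 //.
by apply/rootP; have := horner_map fst r (y, y') => /= ->.
Qed.

End GraphTheory.

Lemma maximal_graph S : graph S ->
  exists T, [/\ graph T, S `<=` T & forall U, graph U -> T `<=` U -> U `<=` T].
Proof.
move=> [Sr KS S0].
have [T [Tr ST T0 Tmax]] :=
  @maximal_subring _ [set z : E * E | z.1 = 0 -> z.2 = 0] S Sr S0.
have TK : diag K `<=` T by exact: subset_trans ST.
by exists T; split=> // U [Ur _ U0] TU; exact: Tmax.
Qed.

Lemma maximal_graph_total T y : graph T ->
  (forall U, graph U -> T `<=` U -> U `<=` T) -> exists y', T (y, y').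
Proof.
move=> Tg Tmax; have [F [Fm FT Fy Fmin]] := graph_minimal_polynomial Tg y.
have : size (map_poly snd F) != 1.
  rewrite size_map_poly_id0; last by rewrite (monicP Fm) oner_neq0.
  apply/eqP => sF; move: Fy.
  have F0 : F`_0 = 1 by rewrite -(monicP Fm) lead_coefE sF.
  by rewrite (size1_polyC (eq_leq sF)) F0 rmorph1 (negbTE (root1 _)).
move/closed_rootP => [y' Fy']; exists y'.
have Ug := graph_adjoin Tg Fm FT Fy Fmin Fy'.
have [Tr _ _] := Tg.
by apply: (Tmax _ Ug (sub_adjoin Tr _)); exact: (adjoin_gen Tr).
Qed.

(** A maximal graph is defined everywhere because E is algebraically closed; the same
    applies to its transpose, so that it is the graph of a bijection. *)
Lemma graph_extension S : graph S ->
  exists s : gal setT K, forall z, S z -> s z.1 = z.2.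
Proof.
move=> Sg; have [T [Tg ST Tmax]] := maximal_graph Sg.
have [Tr TK _] := Tg.
pose f y := sval (cid (maximal_graph_total y Tg Tmax)).
have fT y : T (y, f y) by rewrite /f; case: cid.
have fE z : T z -> f z.1 = z.2.
  by move=> Tz; apply: (graph_fun Tg (fT _)); rewrite -surjective_pairing.
have f_iso : iso_over K setT setT f.
  split.
  - split=> // [x y _ _ e|y _].
      have := graph_snd0 Tg (subringB Tr (fT x) (fT y)).
      by rewrite /= e subrr => /(_ erefl)/eqP; rewrite subr_eq0 => /eqP.
    (* The transpose of T is a maximal graph as well. *)
    have [|x Tx] := @maximal_graph_total _ y (graph_swap Tg).
      move=> U Ug TU z Uz /=; apply: (Tmax _ (graph_swap Ug)) => [w Tw|] /=.
        by apply: TU; rewrite /= -surjective_pairing.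
      by rewrite -surjective_pairing.
    by exists x => //; exact: (fE (x, y)).
  - by move=> x y _ _; exact: (fE (x + y, f x + f y) (subringD Tr (fT x) (fT y))).
  - by move=> x y _ _; exact: (fE (x * y, f x * f y) (subringM Tr (fT x) (fT y))).
  - by move=> x Kx; apply: (fE (x, x)); apply: TK; exists x.
by exists (Gal f_iso (fun x nx => False_ind _ (nx I))) => z Sz; exact/fE/ST.
Qed.

End Graphs.

(** * Minimal polynomials and separable elements *)
Section Separability.
Variables (E : closedFieldType) (K : set E).
Hypothesis K_field : is_subfield K.
Hypothesis K_alg : forall x : E, algebraic_over K x.

Let K_ring := subfield_subring K_field.

Definition is_minimal_polynomial (M : set E) (y : E) (F : {poly E}) :=
  [/\ F \is monic, F \is a polyOver (mem M), root F y &
   forall r, r \is a polyOver (mem M) -> (size r < size F)%N -> root r y -> r = 0].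

Section OverIntermediateField.
Variable M : set E.
Hypotheses (M_field : is_subfield M) (KM : K `<=` M).

Let M_ring := subfield_subring M_field.

Lemma polyOver_sub (q : {poly E}) : q \is a polyOver (mem K) -> q \is a polyOver (mem M).
Proof.
by move=> /(polyOver_setP K_ring) qK; apply/(polyOver_setP M_ring) => i; exact: KM.
Qed.

Lemma has_minimal_polynomial y : exists F, is_minimal_polynomial M y F.
Proof.
have Minv x : M x -> x != 0 -> exists2 w, M w & w * x = 1.
  by move=> Mx x0; exists x^-1; [exact: subfieldV|exact: mulVf].
have [|F [Fm FM Fy Fmin]] := @minimal_polynomial E E idfun M M_ring Minv y.
  have [q [qK q0 qy]] := K_alg y.
  by exists q; split=> //; [exact: polyOver_sub|rewrite map_poly_id].
exists F; split=> //; first by rewrite map_poly_id in Fy.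
by move=> r rM sr ry; apply: Fmin => //; rewrite map_poly_id.
Qed.

Section MinimalPolynomialTheory.
Variables (y : E) (F : {poly E}).
Hypothesis F_min : is_minimal_polynomial M y F.

Lemma minimal_polynomial_neq0 : F != 0.
Proof. by case: F_min => Fm _ _ _; exact: monic_neq0. Qed.

Lemma size_minimal_polynomial : (1 < size F)%N.
Proof.
case: F_min => Fm _ Fy _; rewrite ltnNge; apply/negP => /size1_polyC FE.
have := root_size_gt1 minimal_polynomial_neq0 Fy.
by rewrite FE size_polyC; case: eqP.
Qed.

Lemma minimal_polynomial_dvd p : p \is a polyOver (mem M) -> root p y -> F %| p.
Proof.
case: F_min => Fm FM Fy Fmin pM py.
have [Q [r [QM rM pE sr]]] := monic_division M_ring Fm FM pM.
rewrite pE (Fmin r rM sr) ?addr0 ?dvdp_mulIr //.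
move: py; rewrite pE => /rootP; rewrite hornerD hornerM (rootP Fy) mulr0 add0r.
by move/rootP.
Qed.

(** Divisibility takes place in E[X]; a divisor over M is made monic, so that the
    quotient is again over M and minimality can be applied to it. *)
Lemma minimal_polynomial_irreducible : irreducible_over M F.
Proof.
case: (F_min) => Fm FM Fy Fmin; split=> //; first exact: size_minimal_polynomial.
move=> r0 r0M sr0 r0F.
have r00 : r0 != 0.
  by apply: contraTneq r0F => ->; rewrite dvd0p minimal_polynomial_neq0.
pose r := (lead_coef r0)^-1 *: r0.
have lr0 : (lead_coef r0)^-1 != 0 by rewrite invr_eq0 lead_coef_eq0.
have rr0 : r %= r0 by exact: eqp_scale.
have rm : r \is monic by rewrite monicE lead_coefZ mulVf // lead_coef_eq0.
have rM : r \is a polyOver (mem M).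
  apply/(polyOver_setP M_ring) => i; rewrite coefZ; apply: (subringM M_ring).
    by apply: subfieldV => //; exact: ((polyOver_setP M_ring r0).2 r0M).
  by move: i; exact/(polyOver_setP M_ring).
suff : r %= F by apply: eqp_trans; rewrite eqp_sym.
have rF : r %| F by rewrite (eqp_dvdl _ rr0).
have [Q [s [QM sM FE ss]]] := monic_division M_ring rm rM FM.
have s0 : s = 0.
  have rs : r %| s by have := rF; rewrite FE dvdp_addr // dvdp_mulIr.
  apply/eqP; apply: contraT => sn0.
  by have := dvdp_leq sn0 rs; rewrite leqNgt ss.
rewrite s0 addr0 in FE.
have : root (Q * r) y by rewrite -FE.
rewrite rootM => /orP[Qy|ry]; last first.
  rewrite -(dvdp_size_eqp rF) eqn_leq (dvdp_leq minimal_polynomial_neq0 rF) /=.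
  rewrite leqNgt; apply/negP => /(Fmin _ rM)/(_ ry) r00'.
  by move: rm; rewrite r00' monicE lead_coef0 eq_sym oner_eq0.
have Q0 : Q != 0.
  by apply: contraNneq minimal_polynomial_neq0; rewrite FE => ->; rewrite mul0r.
have : (size Q < size F)%N.
  rewrite FE size_Mmonic // -subn1 -addnBA ?subn1; last first.
    by rewrite lt0n size_poly_eq0 monic_neq0.
  rewrite -[X in (X < _)%N]addn0 ltn_add2l -(eqp_size rr0) in sr0 *.
  have : size r != 0%N by rewrite size_poly_eq0 monic_neq0.
  by case: (size r) sr0 => [|[|]].
by move/(Fmin _ QM)/(_ Qy) => Q0'; rewrite Q0' eqxx in Q0.
Qed.

Lemma conjugate_aut y' : root F y' ->
  exists s : gal setT K, (forall x, M x -> s x = x) /\ s y = y'.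
Proof.
move=> Fy'; pose S := [set (p.[y], p.[y']) | p in [set p | p \is a polyOver (mem M)]].
pose P : subringClosed E := set_pred M_ring.
have polyOverE : polyOver (mem M) = polyOver P by [].
have diagS : diag M `<=` S.
  move=> _ [x Mx <-]; exists x%:P; last by rewrite !hornerC.
  by rewrite /= polyOverE polyOverC; apply/mem_set.
have [|s sS] := @graph_extension E K K_field K_alg S.
  split.
  - apply: subringP; split.
    + exists 1; last by rewrite !hornerC.
      by rewrite /= polyOverE rpred1.
    + move=> _ _ [p /= pM <-] [q /= qM <-]; exists (p - q); rewrite /= ?hornerE //.
      by move: pM qM; rewrite polyOverE => pM qM; rewrite rpredB.
    + move=> _ _ [p /= pM <-] [q /= qM <-]; exists (p * q); rewrite /= ?hornerE //.
      by move: pM qM; rewrite polyOverE => pM qM; rewrite rpredM.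
  - by apply: subset_trans diagS; exact: image_subset.
  - move=> _ [p /= pM <-] /= /rootP py; apply/rootP.
    by move: Fy'; apply: root_dvdp; exact: minimal_polynomial_dvd.
exists s; split=> [x Mx|]; first by apply: (sS (x, x)); apply: diagS; exists x.
apply: (sS (y, y')); exists 'X; last by rewrite !hornerX.
by rewrite /= polyOverE polyOverX.
Qed.

End MinimalPolynomialTheory.

Lemma separable_minimal_polynomial y F h : is_minimal_polynomial M y F ->
  h \is a polyOver (mem M) -> root h y -> separable_poly h -> separable_poly F.
Proof. by move=> Fmin hM hy; apply: dvdp_separable; exact: minimal_polynomial_dvd hy. Qed.

(** The part of infinite Galois theory that is needed: a separable element outside M has
    a second conjugate over M. *)
Lemma moved_by_aut y : separable_over K y -> ~ M y ->
  exists s : gal setT K, (forall x, M x -> s x = x) /\ s y <> y.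
Proof.
move=> [q [[qK _ _] qy qsep]] My; have [F Fmin] := has_minimal_polynomial y.
have Fsep := separable_minimal_polynomial Fmin (polyOver_sub qK) qy qsep.
case: (Fmin) => Fm FM Fy _.
have /factor_theorem[F1 FE] := Fy.
move: Fsep; rewrite FE separable_root => /andP[_ F1y].
have F10 : F1 != 0.
  by apply: contraNneq (minimal_polynomial_neq0 Fmin); rewrite FE => ->; rewrite mul0r.
have sF : size F = (size F1).+1 by rewrite FE size_Mmonic ?monicXsubC // size_XsubC addn2.
have : size F1 != 1%N.
  apply: contra_notN My => /eqP sF1.
  have FE' : F = 'X + (F`_0)%:P.
    apply/polyP => i; rewrite coefD coefX coefC; case: i => [|[|i]] /=.
    + by rewrite add0r.
    + by rewrite addr0 -(monicP Fm) lead_coefE sF sF1.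
    + by rewrite addr0 nth_default // sF sF1.
  have -> : y = - F`_0.
    by move: Fy; rewrite {1}FE' => /rootP/eqP; rewrite hornerD hornerX hornerC addr_eq0 => /eqP.
  by apply: (subringN M_ring); exact: ((polyOver_setP M_ring F).2 FM).
move/closed_rootP => [y' F1y'].
have [|s [sM sy]] := conjugate_aut Fmin (y' := y'); first by rewrite FE rootM F1y'.
by exists s; split=> //; rewrite sy => y'y; rewrite -y'y F1y' in F1y.
Qed.

(** Write u = R(x) with R of degree less than that of the minimal polynomial F of x.
    Then F divides R^p - u^p, so R takes the value u at all roots of F. Since F is
    separable, it has more roots than the degree of R, and R is constant. *)
Lemma separable_descent p x u q : p \in [pchar E] ->
  q \is a polyOver (mem M) -> separable_poly q -> root q x ->
  adjoin M x u -> M (u ^+ p) -> M u.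
Proof.
move=> pE qM qsep qx Mxu Mup; have [F Fmin] := has_minimal_polynomial x.
have Fsep := separable_minimal_polynomial Fmin qM qx qsep.
case: (Fmin) => Fm FM /rootP Fx _.
have [R [RM sR] uE] := adjoinE M_ring Fm FM Fx Mxu.
have Fu r : root F r -> R.[r] = u.
  move=> Fr; pose T := R ^+ p - (u ^+ p)%:P.
  have TM : T \is a polyOver (mem M).
    pose P : subringClosed E := set_pred M_ring.
    have polyOverE : polyOver (mem M) = polyOver P by [].
    move: RM; rewrite polyOverE => RM; rewrite rpredB // ?rpredX // polyOverC.
    exact: mem_set.
  have Tx : root T x by apply/rootP; rewrite !hornerE -uE subrr.
  have /rootP := root_dvdp (minimal_polynomial_dvd Fmin TM Tx) Fr.
  rewrite !hornerE => /eqP; rewrite subr_eq0 => /eqP e.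
  have p_nat : [pchar E].-nat p by rewrite pnatE // (pcharf_prime pE).
  have := exprDn_pchar (R.[r] - u) u p_nat; rewrite subrK e.
  rewrite -{1}[u ^+ p]add0r => /addIr/esym/eqP.
  by rewrite expf_eq0 subr_eq0 => /andP[_ /eqP].
have [rs FE] := closed_field_poly_normal F.
rewrite (monicP Fm) scale1r in FE.
have rsu : uniq rs by rewrite -separable_prod_XsubC -FE.
have : R - u%:P = 0.
  apply/eqP; apply: contraT => /max_poly_roots /(_ _ rsu).
  have -> : all (root (R - u%:P)) rs.
    apply/allP => r rrs; apply/rootP; rewrite !hornerE Fu ?subrr //.
    by rewrite FE root_prod_XsubC.
  have srs : size F = (size rs).+1 by rewrite FE size_prod_XsubC.
  move=> /(_ isT) sRu; have := leq_trans sRu (size_polyD _ _).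
  rewrite size_polyN ltnNge geq_max -ltnS -srs sR /= size_polyC.
  by have := size_minimal_polynomial Fmin; rewrite srs ltnS; case: (u != 0) => // ->.
move/eqP; rewrite subr_eq0 => /eqP RE.
have -> : u = R`_0 by rewrite RE coefC.
by move: RM => /(polyOver_setP M_ring).
Qed.

End OverIntermediateField.
End Separability.

(** * Automorphisms of the algebraic closure and the separable closure *)
Section AutomorphismMorphism.
Variables (E : fieldType) (K : set E).
Implicit Type s : gal (@setT E) K.

Fact autD s x y : s (x + y) = s x + s y.
Proof. by case: (gal_iso s) => _ sD _ _; exact: sD. Qed.

Fact autM s x y : s (x * y) = s x * s y.
Proof. by case: (gal_iso s) => _ _ sM _; exact: sM. Qed.

Fact aut_zmod_morphism s : GRing.zmod_morphism s.
Proof.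
by move=> x y; apply: (addIr (s y)); rewrite -autD !subrK.
Qed.

Fact aut_monoid_morphism s : GRing.monoid_morphism s.
Proof.
split; last exact: autM.
have s1 : s 1 != 0.
  apply/eqP => s1; have s0 : s 0 = 0 by apply: (addIr (s 0)); rewrite -autD !add0r.
  by have /gal_inj/eqP : s 1 = s 0 by [rewrite s1 s0]; rewrite oner_eq0.
by apply: (mulfI s1); rewrite -autM !mulr1.
Qed.

HB.instance Definition _ s := GRing.isZmodMorphism.Build E E s (aut_zmod_morphism s).
HB.instance Definition _ s := GRing.isMonoidMorphism.Build E E s (aut_monoid_morphism s).

Lemma aut_fix s x : K x -> s x = x.
Proof. by case: (gal_iso s) => _ _ _; apply. Qed.

Lemma aut_horner s (q : {poly E}) x : is_subfield K -> q \is a polyOver (mem K) ->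
  s q.[x] = q.[s x].
Proof.
move=> K_field /(polyOver_setP (subfield_subring K_field)) qK.
rewrite -horner_map; congr (_.[_]); apply/polyP => i.
by rewrite coef_map /= aut_fix.
Qed.

End AutomorphismMorphism.

Section SeparableClosure.
Variables (E : closedFieldType) (K : set E).
Hypothesis K_field : is_subfield K.
Hypothesis K_alg : forall x : E, algebraic_over K x.

Let K_ring := subfield_subring K_field.

Lemma separable_overP z h : h \is a polyOver (mem K) -> separable_poly h ->
  root h z -> separable_over K z.
Proof.
move=> hK hsep hz.
have [F Fmin] := has_minimal_polynomial K_field K_alg K_field (@subset_refl _ K) z.
exists F; split; first exact: (minimal_polynomial_irreducible K_field Fmin).
  by case: Fmin.
exact: (separable_minimal_polynomial K_field Fmin hK hz).
Qed.

(** A common root of the minimal polynomial F and its derivative would have F as its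
    minimal polynomial, although the derivative is nonzero and of smaller degree. *)
Lemma separable_char0 z : [pchar E] =i pred0 -> separable_over K z.
Proof.
move=> char0; have [F Fmin] := has_minimal_polynomial K_field K_alg K_field (@subset_refl _ K) z.
case: (Fmin) => Fm FK Fz _.
have F0 := minimal_polynomial_neq0 Fmin.
apply: (separable_overP FK) => //; rewrite separable_poly.unlock.
apply: Pdiv.ClosedField.root_coprimep => r Fr.
apply/negP => F'r.
have [H Hmin] := has_minimal_polynomial K_field K_alg K_field (@subset_refl _ K) r.
case: (Hmin) => Hm HK Hr Hmin'.
have HF : H %| F by exact: (minimal_polynomial_dvd K_field Hmin FK Fr).
have sHF : size H = size F.
  have [_ _ /(_ H HK)] := minimal_polynomial_irreducible K_field Fmin.
  have := size_minimal_polynomial Hmin; rewrite ltn_neqAle eq_sym => /andP[sH _].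
  by move=> /(_ sH HF); apply: eqp_size.
have /Hmin' : F^`() \is a polyOver (mem K).
  apply/(polyOver_setP K_ring) => i; rewrite coef_deriv -mulr_natr.
  apply: (subringM K_ring); last exact: (subring_nat K_ring).
  exact: ((polyOver_setP K_ring F).2 FK).
rewrite sHF lt_size_deriv // => /(_ isT F'r) /(congr1 (fun p : {poly E} => p`_(size F).-2)).
rewrite coef_deriv coef0; have := size_minimal_polynomial Fmin.
case sF : (size F) => [|[|n]] //= _.
have -> : F`_n.+1 = 1 by rewrite -(monicP Fm) lead_coefE sF.
move/eqP => n0; have [p] := natf0_pchar (ltn0Sn n) n0.
by rewrite char0.
Qed.

Lemma adjoin_subfield (M : set E) z : is_subfield M -> K `<=` M -> is_subfield (adjoin M z).
Proof.
move=> M_field KM; have M_ring := subfield_subring M_field.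
apply: (subring_subfield K_field K_alg); first exact: adjoin_ring.
by apply: (subset_trans KM); exact: sub_adjoin.
Qed.

(** In characteristic p, descend from K(z^p, x, y), which contains z, along y and x to
    K(z^p). Then z = u(z^p) for a polynomial u over K, and u(X^p) - X has derivative
    -1. *)
Lemma separable_generated x y z : separable_over K x -> separable_over K y ->
  adjoin (adjoin K x) y z -> separable_over K z.
Proof.
move=> [q [[qK _ _] qx qsep]] [r [[rK _ _] ry rsep]] zKxy.
have [[p pE]|noc] := pselect (exists p, p \in [pchar E]); last first.
  by apply: separable_char0 => p; apply/negP => pE; apply: noc; exists p.
have KK := @subset_refl _ K.
set M := adjoin K (z ^+ p).
have MK : K `<=` M by exact: sub_adjoin.
have M_field : is_subfield M by exact: adjoin_subfield.
have M_ring := subfield_subring M_field.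
have Mzp : M (z ^+ p) by exact: adjoin_gen.
have MMx : M `<=` adjoin M x by exact: sub_adjoin.
have KMx : K `<=` adjoin M x by exact: subset_trans MMx.
have Mx_field : is_subfield (adjoin M x) by exact: adjoin_subfield.
have Mx_ring := subfield_subring Mx_field.
have adjoinS (A B : set E) w : subring_closed (mem A) -> subring_closed (mem B) ->
    A `<=` B -> adjoin A w `<=` adjoin B w.
  move=> Ar Br AB _ [u uA <-]; exists u => //.
  by apply/(polyOver_setP Br) => i; apply: AB; exact: ((polyOver_setP Ar u).2 uA).
have Mz : M z.
  have qM := polyOver_sub K_field M_field MK qK.
  apply: (separable_descent K_field K_alg M_field MK pE qM qsep qx) => //.
  have rMx := polyOver_sub K_field Mx_field KMx rK.
  apply: (separable_descent K_field K_alg Mx_field KMx pE rMx rsep ry).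
    apply: (adjoinS _ _ y _ _ _ _ zKxy); [exact: adjoin_ring|exact: Mx_ring|].
    exact: adjoinS.
  exact: MMx.
case: Mz => u /= uK uz.
(* z is a root of u(X^p) - X, which has derivative -1. *)
pose h := u \Po 'X^p - 'X.
have hK : h \is a polyOver (mem K).
  pose P : subringClosed E := set_pred K_ring.
  have polyOverE : polyOver (mem K) = polyOver P by [].
  move: uK; rewrite polyOverE => uK.
  by rewrite rpredB ?polyOverX // polyOver_comp // rpredX // polyOverX.
apply: (separable_overP hK).
  rewrite separable_poly.unlock; apply: Pdiv.ClosedField.root_coprimep => w _.
  have p0 : p%:R = 0 :> {poly E} by rewrite -polyC_natr (pcharf0 pE).
  rewrite /h derivB derivX deriv_comp derivXn -mulr_natr p0 !mulr0 sub0r.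
  by rewrite hornerN hornerC oppr_eq0 oner_eq0.
by apply/rootP; rewrite /h hornerD hornerN hornerX horner_comp hornerXn uz subrr.
Qed.

Lemma separableD x y : separable_over K x -> separable_over K y -> separable_over K (x + y).
Proof.
move=> xs ys; apply: (separable_generated xs ys).
have Kx_ring := adjoin_ring K_ring x; have Kxy_ring := adjoin_ring Kx_ring y.
apply: (subringD Kxy_ring); last exact: adjoin_gen.
by apply: sub_adjoin => //; exact: adjoin_gen.
Qed.

Lemma separableM x y : separable_over K x -> separable_over K y -> separable_over K (x * y).
Proof.
move=> xs ys; apply: (separable_generated xs ys).
have Kx_ring := adjoin_ring K_ring x; have Kxy_ring := adjoin_ring Kx_ring y.
apply: (subringM Kxy_ring); last exact: adjoin_gen.
by apply: sub_adjoin => //; exact: adjoin_gen.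
Qed.

Lemma separable_aut (s : gal (@setT E) K) x : separable_over K x -> separable_over K (s x).
Proof.
move=> [q [qirr qx qsep]]; exists q; split=> //; case: qirr => qK _ _.
by apply/rootP; rewrite -(aut_horner s _ K_field qK) (rootP qx) rmorph0.
Qed.

Section Restriction.
Variable s : gal (@setT E) K.
Local Notation Ksep := (separable_closure K).

Definition restrict_fun x := if `[< Ksep x >] then s x else x.

Lemma restrict_funE x : Ksep x -> restrict_fun x = s x.
Proof. by rewrite /restrict_fun => /asboolP ->. Qed.

Fact restrict_iso : iso_over K Ksep Ksep restrict_fun.
Proof.
split.
- split=> [x xs|x y /set_mem xs /set_mem ys|y ys].
  + by rewrite restrict_funE //; exact: separable_aut.
  + by rewrite !restrict_funE //; exact: gal_inj.
  + have xs : Ksep (gal_inv s y) by exact: separable_aut.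
    by exists (gal_inv s y) => //; rewrite restrict_funE // /= gal_invK.
- move=> x y xs ys; rewrite !restrict_funE ?rmorphD //; exact: separableD.
- move=> x y xs ys; rewrite !restrict_funE ?rmorphM //; exact: separableM.
- by move=> x Kx; rewrite /restrict_fun; case: ifP => // _; exact: aut_fix.
Qed.

Fact restrict_out x : ~ Ksep x -> restrict_fun x = x.
Proof. by rewrite /restrict_fun; case: asboolP. Qed.

Definition sep_restrict : gal Ksep K := Gal restrict_iso restrict_out.

End Restriction.

End SeparableClosure.

(** * Leading terms *)
Section LeadingTerms.
Variables (E : fieldType) (G : orderedAbGroupType) (v : valuation E G).
Implicit Types (x y z a u : E).

Definition vnneg x := vle (Some 0) (v x).
Definition vpos x := vlt (Some 0) (v x).

Lemma vnnegD x y : vnneg x -> vnneg y -> vnneg (x + y).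
Proof. exact: valuationD_ge. Qed.

Lemma vnnegN x : vnneg (- x) = vnneg x.
Proof. by rewrite /vnneg valuationN. Qed.

Lemma vnnegM x y : vnneg x -> vnneg y -> vnneg (x * y).
Proof. by rewrite /vnneg valuationM; exact: vadd_ge0. Qed.

Lemma vnneg1 : vnneg 1.
Proof. by rewrite /vnneg valuation1 vlexx. Qed.

Lemma vnneg0 : vnneg 0.
Proof. by rewrite /vnneg valuation0. Qed.

Lemma vnnegX x n : vnneg x -> vnneg (x ^+ n).
Proof.
move=> xi; elim: n => [|n IHn]; first exact: vnneg1.
by rewrite exprS; exact: vnnegM.
Qed.

Lemma vnneg_nat n : vnneg n%:R.
Proof.
elim: n => [|n IHn]; first exact: vnneg0.
by rewrite -addn1 natrD; apply: vnnegD => //; exact: vnneg1.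
Qed.

Lemma vpos0 : vpos 0.
Proof. by rewrite /vpos valuation0. Qed.

Lemma vposD x y : vpos x -> vpos y -> vpos (x + y).
Proof. exact: valuationD_gt. Qed.

Lemma vposN x : vpos (- x) = vpos x.
Proof. by rewrite /vpos valuationN. Qed.

Lemma vposB x y : vpos x -> vpos y -> vpos (x - y).
Proof. by move=> xi yi; apply: vposD; rewrite ?vposN. Qed.

Lemma vposMr x a : vpos x -> vnneg a -> vpos (x * a).
Proof. by rewrite /vpos valuationM; exact: vadd_gt0. Qed.

Lemma vposMl x a : vnneg a -> vpos x -> vpos (a * x).
Proof. by move=> ai xi; rewrite mulrC; exact: vposMr. Qed.

Lemma vpos_sum I (r : seq I) (P : pred I) (F : I -> E) :
  (forall i, P i -> vpos (F i)) -> vpos (\sum_(i <- r | P i) F i).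
Proof.
move=> FP; apply: (big_ind vpos) => //; first exact: vpos0.
exact: vposD.
Qed.

Lemma vpos_vnneg x : vpos x -> vnneg x.
Proof. exact: vltW. Qed.

Lemma vpos1 : ~~ vpos 1.
Proof. by rewrite /vpos valuation1 /vlt negbK vlexx. Qed.

Lemma vnnegV x : ~~ vpos x -> vnneg x^-1.
Proof.
move=> xi; have x0 : x != 0 by apply: contraNneq xi => ->; exact: vpos0.
have := valuationM v x x^-1; rewrite divff // valuation1.
move: xi; rewrite /vpos /vnneg /vlt negbK.
case: (v x) => // g; case: (v x^-1) => // h; rewrite /vle => g0 [->].
by rewrite -[leRHS]add0r leDD.
Qed.

Lemma vposV x : ~~ vnneg x -> vpos x^-1.
Proof.
move=> xi; apply: contraNT xi => /vnnegV; by rewrite invrK.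
Qed.

Lemma vposX x n : vpos (x ^+ n) -> vpos x.
Proof.
apply: contraTT => xi; apply/negP => xni.
have x0 : x != 0 by apply: contraNneq xi => ->; exact: vpos0.
have := vpos1; rewrite -(divff (expf_neq0 n x0)) -exprVn.
by rewrite vposMr // vnnegX // vnnegV.
Qed.

Lemma vpos_exp x n : (0 < n)%N -> vpos x -> vpos (x ^+ n).
Proof.
case: n => // n _ xi; rewrite exprS; apply: vposMr => //.
exact/vnnegX/vpos_vnneg.
Qed.

Lemma vnneg_root x n : (0 < n)%N -> vnneg (x ^+ n) -> vnneg x.
Proof.
move=> n0; apply: contraTT => nxi; have xi := vposV nxi.
apply/negP => xni; have x0 : x != 0.
  by apply: contraNneq nxi => ->; exact: vnneg0.
have := vpos1; rewrite -(divff (expf_neq0 n x0)) -exprVn.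
by rewrite vposMl // vpos_exp.
Qed.

(** The relation v x <= v y, phrased as divisibility in the valuation ring. All estimates
    are made with it, which avoids arithmetic with values, in particular with infinity. *)
Definition vdvd x y := exists2 a, vnneg a & y = x * a.

Lemma vdvd_trans x y z : vdvd x y -> vdvd y z -> vdvd x z.
Proof.
move=> [a ai ->] [b bi ->]; exists (a * b); last by rewrite mulrA.
exact: vnnegM.
Qed.

Lemma vdvdN x y : ~ vdvd x y -> exists2 u, vpos u & x = y * u.
Proof.
move=> nxy; have [y0|y0] := eqVneq y 0.
  by case: nxy; exists 0; [exact: vnneg0|rewrite y0 mulr0].
have [x0|x0] := eqVneq x 0.
  by exists 0; [exact: vpos0|rewrite x0 mulr0].
exists (x / y); last by rewrite mulrCA divff ?mulr1.
rewrite -[x / y]invrK invf_div; apply: vposV; apply: contra_notN nxy => h.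
by exists (y / x) => //; rewrite mulrCA divff ?mulr1.
Qed.

Lemma last_minimum (b : nat -> E) n : exists j, [/\ (j <= n)%N,
  forall i, (i <= n)%N -> vdvd (b j) (b i) &
  forall i, (j < i <= n)%N -> exists2 u, vpos u & b i = b j * u].
Proof.
have refl x : vdvd x x by exists 1; [exact: vnneg1|rewrite mulr1].
elim: n => [|n [j [jn jmin jlast]]].
  exists 0%N; split=> // i; rewrite leqn0; first by move=> /eqP ->.
  by case: i.
have [h|/vdvdN h] := pselect (vdvd (b n.+1) (b j)).
  exists n.+1; split=> // i; last by rewrite ltnNge andNb.
  by rewrite leq_eqVlt => /predU1P[->//|]; rewrite ltnS => /jmin; exact: vdvd_trans.
exists j; split=> [|i|i]; first exact: leq_trans jn _.
  rewrite leq_eqVlt => /predU1P[->|]; last by rewrite ltnS; exact: jmin.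
  by case: h => u ui ->; exists u => //; exact: vpos_vnneg.
move=> /andP[ji]; rewrite leq_eqVlt => /predU1P[->//|]; rewrite ltnS => iN.
by apply: jlast; rewrite ji.
Qed.

(** The classes of nonzero elements for this relation are the leading terms of the
    valued field, that is, the quotient of the multiplicative group by the 1-units. *)
Definition rv x y := exists2 u, vpos u & y = x * (1 + u).

Lemma rv_refl x : rv x x.
Proof. by exists 0; [exact: vpos0|rewrite addr0 mulr1]. Qed.

Lemma one_unit u : vpos u -> ~~ vpos (1 + u).
Proof.
move=> ui; apply: contra vpos1 => ui'.
by rewrite -[1](addrK u) vposB.
Qed.

Lemma one_unit_neq0 u : vpos u -> 1 + u != 0.
Proof. by move=> /one_unit; apply: contraNneq => ->; exact: vpos0. Qed.

Lemma rv_sym x y : rv x y -> rv y x.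
Proof.
move=> [u ui ->]; have n0 := one_unit_neq0 ui.
exists (- (u / (1 + u))); last first.
  have -> : 1 - u / (1 + u) = (1 + u)^-1 by rewrite -{1}(divff n0) -mulrBl addrK mul1r.
  by rewrite mulfK.
rewrite vposN; apply: vposMr => //.
exact/vnnegV/one_unit.
Qed.

Lemma rv_trans x y z : rv x y -> rv y z -> rv x z.
Proof.
move=> [u ui ->] [w wi ->]; exists (u + (1 + u) * w).
  apply: vposD => //; apply: vposMl => //.
  by apply: vnnegD; [exact: vnneg1|exact: vpos_vnneg].
by rewrite -mulrA mulrDr mulr1 addrA.
Qed.

Lemma rvM x y z t : rv x y -> rv z t -> rv (x * z) (y * t).
Proof.
move=> [u ui ->] [w wi ->]; exists (u + (1 + u) * w).
  apply: vposD => //; apply: vposMl => //.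
  by apply: vnnegD; [exact: vnneg1|exact: vpos_vnneg].
by rewrite mulrACA addrA; congr (_ * _); rewrite mulrDr mulr1.
Qed.

Lemma rvX x y n : rv x y -> rv (x ^+ n) (y ^+ n).
Proof.
move=> xy; elim: n => [|n IHn]; first exact: rv_refl.
by rewrite !exprS; exact: rvM.
Qed.

Lemma rv_eq0 x y : rv x y -> x = 0 -> y = 0.
Proof. by move=> [u _ ->] ->; rewrite mul0r. Qed.

Lemma rv_vdvd x y : rv x y -> vdvd x y.
Proof.
move=> [u ui ->]; exists (1 + u) => //.
by apply: vnnegD; [exact: vnneg1|exact: vpos_vnneg].
Qed.

Lemma rvP x y : x != 0 -> rv x y <-> vlt (v x) (v (y - x)).
Proof.
move=> x0; have vxu u : vlt (v x) (v (x * u)) = vpos u.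
  rewrite /vpos /vlt valuationM.
  case e : (v x) => [g|]; last by move/valuation_eqT: e x0 => ->; rewrite eqxx.
  case: (v u) => //= h; rewrite /vle; congr negb.
  by rewrite -{2}[g]addr0 leD2l.
have -> : y - x = x * ((y - x) / x) by rewrite mulrCA divff ?mulr1.
rewrite vxu; split=> [[u ui ->]|h].
  by rewrite mulrDr mulr1 addrAC subrr add0r mulrAC divff ?mul1r.
by exists ((y - x) / x) => //; rewrite mulrDr mulr1 mulrCA divff // mulr1 addrC subrK.
Qed.

(** The leading term of a sum depends only on the leading terms of the summands as long
    as there is no cancellation among the terms of smallest value. *)
Lemma rv_sum n (x y : nat -> E) : (forall i, (i < n)%N -> rv (x i) (y i)) ->
  (forall i, (i < n)%N -> vdvd (\sum_(j < n) x j) (x i)) ->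
  rv (\sum_(i < n) x i) (\sum_(i < n) y i).
Proof.
move=> xy dvd; set X := \sum_(i < n) x i in dvd *.
have {}xy i : exists u, (i < n)%N -> vpos u /\ y i = x i + X * u.
  case: (ltnP i n) => [lin|_]; last by exists 0.
  have [u ui ->] := xy _ lin; have [a ai xa] := dvd _ lin.
  exists (a * u) => _; rewrite mulrA -xa mulrDr mulr1; split=> //.
  exact: vposMl.
exists (\sum_(i < n) sval (cid (xy i))).
  by apply: vpos_sum => i _; case: cid => u /= /(_ (ltn_ord i))[].
rewrite mulrDr mulr1 mulr_sumr {1}/X -big_split /=; apply: eq_bigr => i _.
by case: cid => u /= /(_ (ltn_ord i))[].
Qed.

End LeadingTerms.

Section RootNearby.
Variables (E : closedFieldType) (G : orderedAbGroupType) (v : valuation E G).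

(** Otherwise x - r has value at most v x for each of the n roots r, and F(x) has value
    at most n v x. *)
Lemma root_nearby (F : {poly E}) n x u : F \is monic -> size F = n.+1 -> x != 0 ->
  vpos v u -> F.[x] = x ^+ n * u -> exists2 r, root F r & rv v x r.
Proof.
move=> Fm sF x0 ui Fx; have [rs FE] := closed_field_poly_normal F.
rewrite (monicP Fm) scale1r in FE.
have [//|nor] := pselect (exists2 r, root F r & rv v x r).
have rsn : size rs = n by apply: succn_inj; rewrite -sF FE size_prod_XsubC.
suff [a ai ax] : exists2 a, vnneg v a & a * F.[x] = x ^+ n.
  have xn0 := expf_neq0 n x0.
  have au : a * u = 1 by apply: (mulfI xn0); rewrite mulrCA -Fx ax mulr1.
  by have := vpos1 v; rewrite -au vposMl.
have : {in rs, forall r, ~ rv v x r}.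
  by move=> r rrs xr; apply: nor; exists r => //; rewrite FE root_prod_XsubC.
rewrite FE -rsn; elim: rs {FE rsn nor} => [|r rs IHrs] nor.
  by exists 1; [exact: vnneg1|rewrite big_nil hornerC mulr1].
have [s srs|a ai ax] := IHrs; first by apply: nor; rewrite inE srs orbT.
have xr : ~~ vpos v ((x - r) / x).
  have := nor r (mem_head _ _); apply: contra_notN => h.
  exists (- ((x - r) / x)); first by rewrite vposN.
  by rewrite mulrDr mulr1 mulrN mulrCA divff // mulr1 opprB addrC subrK.
exists (((x - r) / x)^-1 * a); first by apply: vnnegM => //; exact: vnnegV.
have xr0 : x - r != 0.
  by apply: contraNneq xr => ->; rewrite mul0r vpos0.
by rewrite big_cons hornerM hornerXsubC invf_div mulrACA ax /= divfK // exprS.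
Qed.

End RootNearby.

(** * Ramified automorphisms *)
Section HomogeneousEquation.
Variables (E : closedFieldType) (G : orderedAbGroupType) (v : valuation E G).
Local Notation rv := (rv v).
Local Notation vdvd := (vdvd v).
Local Notation vpos := (vpos v).
Local Notation vnneg := (vnneg v).

(** An algebraic equation of degree n for the leading term of x over the leading terms
    of M: the terms of F have value at least v (x^n), but they cancel at x. It handles
    residue field extensions and value group extensions on the same footing. *)
Definition leading_equation (M : set E) x n := exists F : {poly E},
  [/\ F \is monic, F \is a polyOver (mem M), size F = n.+1,
      forall i, vdvd (x ^+ n) (F`_i * x ^+ i) &
      exists2 u, vpos u & F.[x] = x ^+ n * u].

(** Keep the terms of p up to the last one of smallest value and divide by the
    coefficient of that one. *)
Lemma leading_equation_of_cancellation (M : set E) x (p : {poly E}) :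
  is_subfield M -> x != 0 -> p \is a polyOver (mem M) ->
  ~ (forall i, vdvd p.[x] (p`_i * x ^+ i)) ->
  exists2 n, (n < size p)%N & leading_equation M x n.
Proof.
move=> M_field x0 pM cancel; have M_ring := subfield_subring M_field.
pose b i := p`_i * x ^+ i.
have int0 y : vdvd y 0 by exists 0; [exact: vnneg0|rewrite mulr0].
case sp : (size p) => [|n].
  case: cancel => i; rewrite nth_default ?sp // mul0r; exact: int0.
have [j [jn jmin jlast]] := last_minimum v b n.
have px : p.[x] = \sum_(i < n.+1) b i by rewrite (horner_coef_wide _ (eq_leq sp)).
have big_b i : (n < i)%N -> b i = 0.
  by move=> ni; rewrite /b nth_default ?mul0r // sp.
have npj : ~ vdvd p.[x] (b j).
  move=> h; apply: cancel => i; apply: vdvd_trans h _.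
  by case: (leqP i n) => [/jmin//|/big_b]; rewrite -/(b i) => ->.
have [u ui pxE] := vdvdN npj.
have pj0 : p`_j != 0.
  by apply/eqP => pj0; apply: npj; rewrite /b pj0 mul0r.
exists j => //; pose F := \poly_(i < j.+1) (p`_i / p`_j).
have Fj : F`_j = 1 by rewrite coef_poly ltnSn divff.
have sF : size F = j.+1 by rewrite size_poly_eq // divff // oner_neq0.
have xj0 := expf_neq0 j x0.
have Mc i : M (p`_i / p`_j).
  apply: (subringM M_ring); first exact: ((polyOver_setP M_ring p).2 pM).
  by apply: subfieldV => //; exact: ((polyOver_setP M_ring p).2 pM).
have bE i : p`_i / p`_j * x ^+ i = b i / p`_j by rewrite mulrAC.
exists F; split=> //.
- by rewrite monicE lead_coefE sF Fj.
- apply/(polyOver_setP M_ring) => i; rewrite coef_poly; case: ifP => // _.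
  exact: (subring0 M_ring).
- move=> i; rewrite coef_poly; case: ltnP => [|_]; last by rewrite mul0r.
  rewrite ltnS bE => ij; have [a ai ->] := jmin i (leq_trans ij jn).
  by exists a => //; rewrite /b mulrAC [p`_j * _]mulrC mulfK.
have tail i : exists w, vpos w /\ ((j < i <= n)%N -> b i = b j * w).
  case h : (j < i <= n)%N; first by have [w wi ->] := jlast i h; exists w.
  by exists 0; split=> //; exact: vpos0.
pose w i := sval (cid (tail i)).
have wi i : vpos (w i) by rewrite /w; case: cid => ? [].
have wb i : (j < i <= n)%N -> b i = b j * w i by rewrite /w; case: cid => ? [].
(* F(x) is p(x) / p_j without the terms beyond j, which have larger value. *)
exists (u - \sum_(j.+1 <= i < n.+1) w i).
  by apply: vposB => //; exact: vpos_sum.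
apply: (mulfI pj0).
have -> : p`_j * F.[x] = \sum_(i < j.+1) b i.
  rewrite (horner_coef_wide _ (eq_leq sF)) mulr_sumr; apply: eq_bigr => i _.
  by rewrite coef_poly ltn_ord bE mulrC divfK.
have tail_sum : \sum_(j.+1 <= i < n.+1) b i = \sum_(j.+1 <= i < n.+1) b j * w i.
  by apply: eq_big_nat => i; rewrite ltnS => /wb.
rewrite mulrA -/(b j) mulrBr -pxE px mulr_sumr -tail_sum.
by rewrite -!(big_mkord xpredT b) [in RHS](big_cat_nat (n := j.+1)) //= addrK.
Qed.

End HomogeneousEquation.

Section Ramification.
Variables (E : closedFieldType) (G : orderedAbGroupType) (v : valuation E G) (K : set E).
Hypothesis K_field : is_subfield K.
Hypothesis K_alg : forall x : E, algebraic_over K x.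
Hypothesis K_hens : henselian v K.
Local Notation rv := (rv v).
Local Notation vdvd := (vdvd v).
Local Notation vpos := (vpos v).
Local Notation vnneg := (vnneg v).
Local Notation aut := (gal (@setT E) K).

Let K_ring := subfield_subring K_field.

(** The valuation [v \o s] agrees with [v] on K, hence is equivalent to it. *)
Lemma aut_vpos (s : aut) u : vpos u -> vpos (s u).
Proof.
have [w' w'E] : exists w' : valuation E G, forall x, w' x = v (s x).
  have eqT x : v (s x) = None <-> x = 0.
    split=> [/valuation_eqT|->]; last by rewrite rmorph0 valuation0.
    by move/eqP; rewrite fmorph_eq0 => /eqP.
  have wM x y : v (s (x * y)) = vadd (v (s x)) (v (s y)) by rewrite rmorphM valuationM.
  have wD x y : vle (v (s x)) (v (s (x + y))) || vle (v (s y)) (v (s (x + y))).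
    by rewrite rmorphD; exact: valuationD.
  by exists (Valuation eqT wM wD).
have /K_hens/(_ u 1 I I) : equivalent_on v K w'.
  by move=> x y Kx Ky; rewrite !w'E !aut_fix.
rewrite !w'E rmorph1 !valuation1 => h.
by move=> /negP nu; apply/negP => /h.
Qed.

Lemma aut_vposE (s : aut) u : vpos (s u) = vpos u.
Proof.
apply/idP/idP; last exact: aut_vpos.
by move/(aut_vpos (gal_inv s)); rewrite /= galK.
Qed.

Lemma aut_vnneg (s : aut) x : vnneg (s x) = vnneg x.
Proof.
have [->|x0] := eqVneq x 0; first by rewrite rmorph0.
have h y : y != 0 -> vnneg y = ~~ vpos y^-1.
  move=> y0; apply/idP/idP => [yi|/vnnegV]; last by rewrite invrK.
  by apply: contra (vpos1 v) => ?; rewrite -(divff y0) vposMl.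
by rewrite !h ?fmorph_eq0 // -fmorphV aut_vposE.
Qed.

Lemma aut_rv (s : aut) x y : rv x y -> rv (s x) (s y).
Proof.
move=> [u ui ->]; exists (s u); first exact: aut_vpos.
by rewrite rmorphM rmorphD rmorph1.
Qed.

Definition ramified (s : aut) := forall x, rv x (s x).

Definition rv_graph (S : set (E * E)) := [/\ subring_closed (mem S), diag K `<=` S &
  forall z, S z -> rv z.1 z.2].

Lemma rv_graphW S : rv_graph S -> graph K S.
Proof. by move=> [Sr KS Srv]; split=> // z /Srv; exact: rv_eq0. Qed.

(** Take an equation F of minimal degree n for the leading term of x over the domain M
    of S. By minimality polynomials over M of degree less than n show no cancellation
    at x. The leading term of x contains a root r of F, that of r contains a root r' of
    the image of F, because S preserves leading terms. Adjoining (r, r') to S still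
    preserves leading terms, by the absence of cancellation. Hence r is already in M. *)
Lemma maximal_rv_graph S x : rv_graph S ->
  (forall T, subring_closed (mem T) -> S `<=` T -> T `<=` [set z | rv z.1 z.2] -> T `<=` S) ->
  x != 0 -> exists z, S z /\ rv x z.1.
Proof.
move=> Srv Smax x0; have Sg := rv_graphW Srv; case: (Srv) => Sr KS Srel.
pose M := [set x | exists y, S (x, y)].
have KM : K `<=` M by move=> k Kk; exists k; apply: KS; exists k.
have M_ring : subring_closed (mem M).
  apply: subringP; split; first by exists 1; exact: (subring1 Sr).
    by move=> a b [a' Sa] [b' Sb]; exists (a' - b'); exact: (subringB Sr Sa Sb).
  by move=> a b [a' Sa] [b' Sb]; exists (a' * b'); exact: (subringM Sr Sa Sb).
have M_field : is_subfield M by exact: (subring_subfield K_field K_alg).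
pose D n := `[< leading_equation v M x n >].
have exD : exists n, D n.
  have [q [qK q0 qx]] := K_alg x.
  have qM : q \is a polyOver (mem M).
    by apply/(polyOver_setP M_ring) => i; apply: KM; exact: ((polyOver_setP K_ring q).2 qK).
  have [|n _ nD] := leading_equation_of_cancellation (v := v) M_field x0 qM.
    move=> /(_ (size q).-1)[a _]; rewrite (rootP qx) mul0r => /eqP.
    rewrite mulf_eq0 expf_eq0 (negbTE x0) andbF orbF -lead_coefE lead_coef_eq0.
    by rewrite (negbTE q0).
  by exists n; apply/asboolP.
have [n /asboolP[F [Fm FM sF Fdvd [u ui Fx]]] nmin] := ex_minnP exD.
have [r Fr xr] := root_nearby Fm sF x0 ui Fx.
have r0 : r != 0.
  by apply: contraNneq x0 => /(rv_eq0 (rv_sym xr)) ->.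
have nocancel_x (p : {poly E}) i : p \is a polyOver (mem M) -> (size p <= n)%N ->
    vdvd p.[x] (p`_i * x ^+ i).
  move=> pM sp; move: i; apply: contrapT.
  move=> /(leading_equation_of_cancellation M_field x0 pM)[m mp /asboolP/nmin].
  by rewrite leqNgt (leq_trans mp).
have nocancel (p : {poly E}) i : p \is a polyOver (mem M) -> (size p <= n)%N ->
    vdvd p.[r] (p`_i * r ^+ i).
  move=> pM sp; have term j : rv (p`_j * x ^+ j) (p`_j * r ^+ j).
    by apply: rvM; [exact: rv_refl|exact: rvX].
  have pxr : rv p.[x] p.[r].
    rewrite !(horner_coef_wide _ sp).
    apply: (rv_sum (x := fun j => p`_j * x ^+ j) (y := fun j => p`_j * r ^+ j)) => j _ //.
    by rewrite -(horner_coef_wide _ sp); exact: nocancel_x.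
  apply: (vdvd_trans (rv_vdvd (rv_sym pxr))).
  exact: vdvd_trans (nocancel_x p i pM sp) (rv_vdvd (term i)).
pose lift a := if pselect (M a) is left Ma then sval (cid Ma) else 0.
have liftP a : M a -> S (a, lift a).
  by move=> Ma; rewrite /lift; case: pselect => // Ma'; case: cid.
have FMi i : M F`_i by exact: ((polyOver_setP M_ring F).2 FM).
pose F2 : {poly E * E} := \poly_(i < n.+1) (F`_i, lift F`_i).
have F2n : F2`_n = 1.
  have Fn : F`_n = 1 by rewrite -(monicP Fm) lead_coefE sF.
  rewrite coef_poly ltnSn Fn.
  have -> // : lift 1 = 1.
  by apply: (graph_fun Sg (x := 1)); [exact: (liftP _ (subring1 M_ring))|exact: (subring1 Sr)].
have sF2 : size F2 = n.+1.
  by rewrite size_poly_eq //; move: F2n; rewrite coef_poly ltnSn => ->; exact: oner_neq0.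
have F2m : F2 \is monic by rewrite monicE lead_coefE sF2 F2n.
have F2S : F2 \is a polyOver (mem S).
  apply/(polyOver_setP Sr) => i; rewrite coef_poly; case: ifP => _.
    exact: liftP.
  exact: (subring0 Sr).
have F2fst : map_poly fst F2 = F.
  apply/polyP => i; rewrite coef_map coef_poly; case: ltnP => //= h.
  by rewrite nth_default // sF.
pose F' := map_poly snd F2.
have F'm : F' \is monic by rewrite monic_map.
have sF' : size F' = n.+1.
  by rewrite size_map_poly_id0 // (monicP F2m) oner_neq0.
(* As F vanishes at r, its image F' takes there the value of the difference. *)
have [w wi F'r] : exists2 w, vpos w & F'.[r] = r ^+ n * w.
  have term i : exists w, vpos w /\ F'`_i * r ^+ i - F`_i * r ^+ i = r ^+ n * w.
    have [c ci Fc] : vdvd (r ^+ n) (F`_i * r ^+ i).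
      have rxn : rv (r ^+ n) (x ^+ n) by apply/rvX/rv_sym.
      apply: vdvd_trans (rv_vdvd rxn) _; apply: vdvd_trans (Fdvd i) _.
      by apply: rv_vdvd; apply: rvM; [exact: rv_refl|exact: rvX].
    have [u' u'i e] : rv F`_i F'`_i.
      by have := Srel F2`_i ((polyOver_setP Sr F2).2 F2S i); rewrite -F2fst !coef_map.
    exists (c * u'); split; first exact: vposMl.
    by rewrite e mulrA -Fc mulrDr mulr1 mulrDl addrAC subrr add0r mulrAC.
  exists (\sum_(i < n.+1) sval (cid (term i))).
    by apply: vpos_sum => i _; case: cid => ? [].
  have -> : F'.[r] = \sum_(i < n.+1) (F'`_i * r ^+ i - F`_i * r ^+ i).
    rewrite sumrB -(horner_coef_wide _ (eq_leq sF')) -(horner_coef_wide _ (eq_leq sF)).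
    by rewrite (rootP Fr) subr0.
  by rewrite mulr_sumr; apply: eq_bigr => i _; case: cid => ? [].
have [r' F'r' rr'] := root_nearby F'm sF' r0 wi F'r.
have F2z : F2.[(r, r')] = 0 by apply: root_map_pair => //; rewrite F2fst.
suff Smax' : adjoin S (r, r') `<=` S.
  by exists (r, r'); split=> //; apply: Smax'; exact: adjoin_gen.
apply: Smax; [exact: adjoin_ring|exact: sub_adjoin|].
move=> _ /(adjoinE Sr F2m F2S F2z)[R [RS sR] ->] /=.
have sR1 : (size R <= n)%N by rewrite -ltnS -sF2.
have RSi i : S R`_i by exact: ((polyOver_setP Sr R).2 RS).
have R1 : R.[(r, r')].1 = \sum_(i < n) (R`_i).1 * r ^+ i.
  rewrite (horner_coef_wide _ sR1) (rmorph_sum fst); apply: eq_bigr => i _.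
  by rewrite rmorphM rmorphXn.
have R2 : R.[(r, r')].2 = \sum_(i < n) (R`_i).2 * r' ^+ i.
  rewrite (horner_coef_wide _ sR1) (rmorph_sum snd); apply: eq_bigr => i _.
  by rewrite rmorphM rmorphXn.
rewrite R1 R2.
apply: (rv_sum (x := fun i => (R`_i).1 * r ^+ i) (y := fun i => (R`_i).2 * r' ^+ i)) => i lin.
  by apply: rvM; [exact: Srel|exact: rvX].
rewrite -R1; have := nocancel (map_poly fst R) i.
have := horner_map fst R (r, r') => /= ->; rewrite coef_map; apply.
  apply/(polyOver_setP M_ring) => j; rewrite coef_map /=; exists (R`_j).2.
  by rewrite -surjective_pairing.
exact: leq_trans (size_poly _ _) sR1.
Qed.

(** This replaces the structure theory of the ramification group: the automorphisms
    over a purely wild extension M represent all classes modulo ramified ones.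

    Extend the restriction of s to M to a maximal isomorphism that preserves leading terms.
    Its domain contains an element of every leading term, so that, K being henselian,
    each of its extensions to E preserves leading terms. *)
Theorem ramified_extension (M : set E) (s : aut) : is_subfield M -> K `<=` M ->
  (forall x, M x -> rv x (s x)) ->
  exists n : aut, ramified n /\ forall x, M x -> n x = s x.
Proof.
move=> M_field KM Ms; have M_ring := subfield_subring M_field.
pose S0 : set (E * E) := [set (x, s x) | x in M].
have S0r : subring_closed (mem S0).
  apply: subringP; split.
  - by exists 1; [exact: (subring1 M_ring)|rewrite rmorph1].
  - move=> _ _ [x Mx <-] [y My <-]; exists (x - y); last by rewrite rmorphB.
    exact: (subringB M_ring).
  - move=> _ _ [x Mx <-] [y My <-]; exists (x * y); last by rewrite rmorphM.
    exact: (subringM M_ring).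
have S0K : diag K `<=` S0.
  by move=> _ [x Kx <-]; exists x; [exact: KM|rewrite aut_fix].
have S0rv : S0 `<=` [set z | rv z.1 z.2] by move=> _ [x Mx <-]; exact: Ms.
have [S [Sr S0S Srel Smax]] := maximal_subring S0r S0rv.
have Srv : rv_graph S by split=> //; exact: subset_trans S0S.
have [n nS] := graph_extension K_field K_alg (rv_graphW Srv).
exists n; split=> [x|x Mx]; last by apply: (nS (x, s x)); apply: S0S; exists x.
have [->|x0] := eqVneq x 0; first by rewrite rmorph0; exact: rv_refl.
have [z [Sz xz]] := maximal_rv_graph Srv Smax x0.
apply: (rv_trans xz); apply: (rv_trans (Srel _ Sz)).
by rewrite -(nS _ Sz); apply: aut_rv; exact: rv_sym.
Qed.

Lemma ramifiedV (s : aut) : ramified s -> ramified (gal_inv s).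
Proof. by move=> sr x; have := sr (gal_inv s x); rewrite /= gal_invK => /rv_sym. Qed.

End Ramification.

(** * Residues and purely wild extensions *)
Section ResidueMorphism.
Variables (E : fieldType) (G : orderedAbGroupType) (v : valuation E G).

Fact residue_zmod_morphism : GRing.zmod_morphism (@residue E G v).
Proof. by move=> x y; apply: (addIr (residue y)); rewrite -residueD !subrK. Qed.

Fact residue_monoid_morphism : GRing.monoid_morphism (@residue E G v).
Proof. by split; [exact: residue1|exact: residueM]. Qed.

HB.instance Definition _ := GRing.isZmodMorphism.Build (valring v) (residue_field v)
  (@residue E G v) residue_zmod_morphism.
HB.instance Definition _ := GRing.isMonoidMorphism.Build (valring v) (residue_field v)
  (@residue E G v) residue_monoid_morphism.

End ResidueMorphism.

Section Residues.
Variables (E : fieldType) (G : orderedAbGroupType) (v : valuation E G).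
Implicit Types x y : E.
Local Notation vring := (valring v).

(** A total function, so that residues of expressions in E can be taken without proofs of
    integrality inside terms; it is meaningful on the valuation ring only. *)
Definition res x : residue_field v := residue (insubd (0 : vring) x).

Lemma insubd_val x : vnneg v x -> val (insubd (0 : vring) x) = x.
Proof. by move=> xi; rewrite insubdK. Qed.

Lemma res_val (w : vring) : res (val w) = residue w.
Proof. by rewrite /res valKd. Qed.

Lemma vnneg_val (w : vring) : vnneg v (val w).
Proof. exact: valring_valP. Qed.

Lemma residue_val_eq (w z : vring) : residue w = residue z <-> vpos v (val w - val z).
Proof.
by rewrite -[vpos _ _]/(w - z \in @maxideal E G v) -residue_eq; split=> /eqP.
Qed.

Lemma res_eq x y : vnneg v x -> vnneg v y -> res x = res y <-> vpos v (x - y).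
Proof. by move=> xi yi; rewrite /res residue_val_eq !insubd_val. Qed.

Lemma resD x y : vnneg v x -> vnneg v y -> res (x + y) = res x + res y.
Proof.
move=> xi yi; rewrite /res -residueD; congr residue; apply: val_inj.
by rewrite rmorphD /= !insubd_val // vnnegD.
Qed.

Lemma resM x y : vnneg v x -> vnneg v y -> res (x * y) = res x * res y.
Proof.
move=> xi yi; rewrite /res -residueM; congr residue; apply: val_inj.
by rewrite rmorphM /= !insubd_val // vnnegM.
Qed.

Lemma res1 : res 1 = 1.
Proof.
by rewrite /res -residue1; congr residue; apply: val_inj; rewrite insubd_val // vnneg1.
Qed.

Lemma res0 : res 0 = 0.
Proof.
by rewrite /res -residue0; congr residue; apply: val_inj; rewrite insubd_val // vnneg0.
Qed.

Lemma resN x : vnneg v x -> res (- x) = - res x.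
Proof.
move=> xi; apply/eqP; rewrite -addr_eq0 -resD ?vnnegN //.
by rewrite addrC subrr res0.
Qed.

Lemma resB x y : vnneg v x -> vnneg v y -> res (x - y) = res x - res y.
Proof. by move=> xi yi; rewrite resD ?vnnegN // resN. Qed.

Lemma resX x n : vnneg v x -> res (x ^+ n) = res x ^+ n.
Proof.
move=> xi; elim: n => [|n IHn]; first by rewrite expr0 res1 expr0.
by rewrite exprS (resM xi (vnnegX n xi)) IHn -exprS.
Qed.

Lemma res_nat n : res n%:R = n%:R.
Proof.
elim: n => [|n IHn]; first exact: res0.
by rewrite [in LHS]mulrSr [RHS]mulrSr (resD (vnneg_nat v n) (vnneg1 v)) IHn res1.
Qed.

Lemma res_eq0 x : vnneg v x -> res x = 0 <-> vpos v x.
Proof. by move=> xi; rewrite -res0 res_eq ?vnneg0 // subr0. Qed.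

Lemma rv_unit x y : ~~ vpos v x -> vpos v (y - x) -> rv v x y.
Proof.
move=> xu yx; have x0 : x != 0 by apply: contraNneq xu => ->; exact: vpos0.
exists ((y - x) / x); first by apply: vposMr => //; exact: vnnegV.
by rewrite mulrDr mulr1 mulrCA divff // mulr1 addrC subrK.
Qed.

Lemma rv_vpos_sub x y : vnneg v x -> rv v x y -> vpos v (y - x).
Proof.
move=> xi [u ui ->]; rewrite mulrDr mulr1 addrAC subrr add0r.
exact: vposMl.
Qed.

Lemma rv_vnneg x y : rv v x y -> vnneg v x -> vnneg v y.
Proof. by move=> /rv_vdvd[a ai ->] xi; exact: vnnegM. Qed.

Lemma valuationX x n g : v x = Some g -> v (x ^+ n) = Some (g *+ n).
Proof.
move=> vx; elim: n => [|n IHn]; first by rewrite valuation1.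
by rewrite exprS valuationM vx IHn /= mulrS.
Qed.

Lemma rv_valuation x y : rv v x y -> v y = v x.
Proof.
move=> [u ui ->]; rewrite valuationM.
have -> : v (1 + u) = Some 0.
  have := one_unit ui; have : vnneg v (1 + u).
    by apply: vnnegD; [exact: vnneg1|exact: vpos_vnneg].
  rewrite /vnneg /vpos /vlt negbK; case: (v _) => // g; rewrite /vle => g0 g0'.
  by congr Some; apply/eqP; rewrite eq_le g0 g0'.
by case: (v x) => //= g; rewrite addr0.
Qed.

Lemma valuation_eq_unit x y g : v x = Some g -> v y = Some g ->
  vnneg v (x / y) /\ ~~ vpos v (x / y).
Proof.
move=> vx vy; have y0 : y != 0 by apply/eqP => /(valuation_eqT v); rewrite vy.
have := valuationM v (x / y) y; rewrite divfK // vx vy /vnneg /vpos.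
case: (v (x / y)) => //= h [/eqP]; rewrite -{1}[g]add0r => /eqP/addIr <-.
by rewrite /vlt negbK vlexx.
Qed.

End Residues.

Section PurelyWild.
Variables (p : nat) (E : closedFieldType) (G : orderedAbGroupType).
Variables (v : valuation E G) (K : set E).
Hypothesis K_field : is_subfield K.
Hypothesis K_alg : forall x : E, algebraic_over K x.
Hypothesis K_hens : henselian v K.
Hypothesis char_p : p \in [pchar (residue_field v)].
Local Notation rv := (rv v).
Local Notation vpos := (vpos v).
Local Notation vnneg := (vnneg v).
Local Notation aut := (gal (@setT E) K).

Let K_ring := subfield_subring K_field.

(** The elementwise form of pure wildness. *)
Definition wild_element x := exists N, exists2 k, K k & rv k (x ^+ (p ^ N)).

Lemma pchar_prime : prime p.
Proof. exact: pcharf_prime char_p. Qed.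

Lemma vpos_nat n : vpos n%:R = (p %| n)%N.
Proof.
have := res_eq0 (vnneg_nat v n); rewrite res_nat => h.
rewrite (dvdn_pcharf char_p); apply/idP/eqP; first by move/h.2.
by move/h.1.
Qed.

(** A power x^(p^n) has the value of an element k of K, and the residue of the unit
    x^(p^n) / k has a p-power in the residue field of K. *)
Lemma purely_wildP M : purely_wild p v K M <->
  [/\ is_subfield M, K `<=` M & forall x, M x -> wild_element x].
Proof.
split=> [[M_field KM vM rM]|[M_field KM Mw]].
  split=> // x Mx; case vx : (v x) => [g|]; last first.
    move/valuation_eqT: vx => ->; exists 0%N, 0; first exact: (subring0 K_ring).
    by rewrite expn0 expr1; exact: rv_refl.
  have [n [k Kk vk]] := vM g (ex_intro2 _ _ x Mx vx).
  have k0 : k != 0 by apply/eqP => /(valuation_eqT v); rewrite vk.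
  have [wi wu] := valuation_eq_unit (valuationX (p ^ n) vx) vk.
  set w := x ^+ (p ^ n) / k in wi wu.
  have M_ring := subfield_subring M_field.
  have Mw : M w.
    apply: (subringM M_ring); first exact: subringX.
    by apply: subfieldV => //; exact: KM.
  have [|m [k1 Kk1 /esym]] := rM (res v w).
    by exists (insubd 0 w) => //=; rewrite insubd_val.
  rewrite -resX // -res_val; have wim : vnneg (w ^+ (p ^ m)) by exact: vnnegX.
  move=> /(res_eq wim (vnneg_val k1)) wk1.
  exists (n + m)%N, (val k1 * k ^+ (p ^ m)).
    apply: (subringM K_ring) => //; exact: (subringX K_ring).
  have -> : x ^+ (p ^ (n + m)) = w ^+ (p ^ m) * k ^+ (p ^ m).
    by rewrite -exprMn divfK // expnD exprM.
  apply: rvM; last exact: rv_refl.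
  apply: rv_sym; apply: rv_unit; last by rewrite -vposN opprB.
  by apply: contra wu; exact: vposX.
split=> //.
  move=> g [x Mx vx]; have [N [k Kk kx]] := Mw x Mx.
  by exists N; exists k => //; rewrite -(rv_valuation kx); exact: valuationX.
move=> _ [w Mx <-]; have [N [k Kk kx]] := Mw _ Mx.
have ki : vnneg k by apply: (rv_vnneg (rv_sym kx)); apply: vnnegX; exact: vnneg_val.
exists N; exists (insubd 0 k); first by rewrite /= insubd_val.
rewrite -[LHS]/(res v k) -[in RHS]res_val -resX ?vnneg_val //.
apply/esym/(res_eq _ ki); first by apply: vnnegX; exact: vnneg_val.
exact: rv_vpos_sub.
Qed.

Lemma frobenius_inj (a b : residue_field v) N : a ^+ (p ^ N) = b ^+ (p ^ N) -> a = b.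
Proof.
move=> ab; have pnat_N : [pchar (residue_field v)].-nat (p ^ N)%N.
  by rewrite pnatX pnatE ?pchar_prime // char_p.
have := exprDn_pchar (a - b) b pnat_N; rewrite subrK ab -{1}[b ^+ _]add0r.
by move/addIr/esym/eqP; rewrite expf_eq0 subr_eq0 => /andP[_ /eqP].
Qed.

(** The quotient of s x by x has a p-power with residue 1, and Frobenius is injective on
    the residue field. *)
Lemma wild_element_rv x (s : aut) : wild_element x -> rv x (s x).
Proof.
move=> [N [k Kk kx]]; have [->|x0] := eqVneq x 0; first by rewrite rmorph0; exact: rv_refl.
have xsx : rv (x ^+ (p ^ N)) (s x ^+ (p ^ N)).
  rewrite -rmorphXn; apply: rv_trans (rv_sym kx) _.
  by rewrite -(aut_fix s Kk); exact: (aut_rv K_hens).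
pose t := s x / x; have pN0 : (0 < p ^ N)%N by rewrite expn_gt0 prime_gt0 ?pchar_prime.
have [u ui tE] : exists2 u, vpos u & t ^+ (p ^ N) = 1 + u.
  case: xsx => u ui e; exists u => //.
  by rewrite expr_div_n e mulrC mulKf // expf_neq0.
have u1i : vnneg (1 + u) by apply: vnnegD; [exact: vnneg1|exact: vpos_vnneg].
have ti : vnneg t by apply: (vnneg_root pN0); rewrite tE.
have t1 : vpos (t - 1).
  apply/(res_eq ti (vnneg1 v)); apply: (@frobenius_inj _ _ N).
  rewrite -!resX ?vnneg1 // tE expr1n; apply/(res_eq u1i (vnneg1 v)).
  by rewrite addrC addKr.
exists (t - 1) => //; by rewrite addrC subrK mulrC divfK.
Qed.

Lemma scaled_prod_coef (I : Type) (rs : seq I) (a : I -> E) x i :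
  (\prod_(r <- rs) ('X - (x * a r)%:P))`_i * x ^+ i =
  x ^+ size rs * (\prod_(r <- rs) ('X - (a r)%:P))`_i.
Proof.
elim: rs i => [|r rs IHrs] i.
  rewrite !big_nil !coef1 expr0 mul1r; case: i => [|i]; first by rewrite expr0 mulr1.
  by rewrite mul0r.
rewrite !big_cons !mulrBl !coefB !coefCM !coefXM exprS.
case: i => [|i] /=.
  have := IHrs 0%N; rewrite expr0 !mulr1 => ->; by ring.
have := IHrs i; have := IHrs i.+1; rewrite exprS.
move: (x ^+ size rs) (x ^+ i) => X Xi IH1 IH0.
rewrite mulrBl; set P0 := _`_i in IH0 *; set P1 := _`_i.+1 in IH1 *.
have -> : P0 * (x * Xi) = x * (P0 * Xi) by ring.
have -> : x * a r * P1 * (x * Xi) = x * a r * (P1 * (x * Xi)) by ring.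
rewrite IH0 IH1; by ring.
Qed.

(** Here (X - 1)^(m p^N) = (X^(p^N) - 1)^m. *)
Lemma coef_unipotent (R : comNzRingType) N m : p \in [pchar R] -> (0 < m)%N ->
  (('X - 1 : {poly R}) ^+ (m * p ^ N))`_(m.-1 * p ^ N) = - m%:R.
Proof.
move=> Rp m0; have Pp : p \in [pchar {poly R}] by rewrite pchar_poly.
have pp := pcharf_prime Rp.
have pN0 : (0 < p ^ N)%N by rewrite expn_gt0 prime_gt0.
have pnatP : [pchar {poly R}].-nat (p ^ N)%N by rewrite pnatX pnatE // Pp.
have -> : ('X - 1 : {poly R}) ^+ (m * p ^ N) = (('X - 1) ^+ m) \Po 'X^(p ^ N).
  rewrite rmorphXn /= comp_polyB comp_polyX comp_polyC mulnC exprM; congr (_ ^+ m).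
  have := exprDn_pchar ('X - 1 : {poly R}) 1 pnatP.
  by rewrite subrK expr1n => ->; rewrite addrK.
rewrite coef_comp_poly_Xn // dvdn_mull // mulnK //.
have -> : ('X - 1 : {poly R}) ^+ m = \prod_(r <- nseq m (1 : R)) ('X - r%:P).
  by rewrite big_nseq iter_mulr_1.
have := @coefPn_prod_XsubC R (nseq m 1); rewrite size_nseq => -> //; last by rewrite -lt0n.
by rewrite big_nseq iter_addr_0.
Qed.

(** If all conjugates of x have the leading term of x, then the minimal polynomial of x
    has the leading behaviour of (X - x)^d. Write d = m p^N with m prime to p: up to
    1-units, its coefficient of degree d - p^N is - m x^(p^N), and it lies in K. *)
Lemma wild_element_of_rv x : (forall s : aut, rv x (s x)) -> wild_element x.
Proof.
move=> xs; have [->|x0] := eqVneq x 0.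
  exists 0%N, 0; first exact: (subring0 K_ring).
  by rewrite expn0 expr1; exact: rv_refl.
have KK := @subset_refl _ K.
have [F Fmin] := has_minimal_polynomial K_field K_alg K_field KK x.
case: (Fmin) => Fm FK Fx _; have [rs FE] := closed_field_poly_normal F.
rewrite (monicP Fm) scale1r in FE.
have rsP r : r \in rs -> vnneg (r / x) /\ vpos (r / x - 1).
  move=> rrs; have Fr : root F r by rewrite FE root_prod_XsubC.
  have [s [_ sx]] := conjugate_aut K_field K_alg K_field KK Fmin Fr.
  have [u ui e] := xs s; rewrite -sx e mulrAC divff // mul1r.
  by split; [apply: vnnegD; [exact: vnneg1|exact: vpos_vnneg]|rewrite addrC addKr].
have d0 : (0 < size rs)%N.
  by have := size_minimal_polynomial Fmin; rewrite FE size_prod_XsubC.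
have [m pm dE] := pfactor_coprime pchar_prime d0.
set N := logn p (size rs) in dE.
have m0 : (0 < m)%N by case: (m) dE d0 => // ->.
pose w r : valring v := insubd 0 (r / x).
pose B := \prod_(r <- rs) ('X - (w r)%:P).
(* B is F(x X) / x^d, with coefficients in the valuation ring. *)
pose j := (m.-1 * p ^ N)%N; pose b := B`_j.
have dj : size rs = (p ^ N + j)%N by rewrite dE /j -mulSn prednK.
have Fj : F`_j = x ^+ (p ^ N) * val b.
  have FB : F = \prod_(r <- rs) ('X - (x * val (w r))%:P).
    rewrite FE !big_seq; apply: eq_bigr => r rrs.
    by rewrite insubd_val ?(rsP r rrs).1 // mulrC divfK.
  have := scaled_prod_coef rs (fun r => val (w r)) x j.
  rewrite -FB -(map_prod_XsubC val) coef_map dj exprD -mulrA [x ^+ j * _]mulrC mulrA.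
  exact: (mulIf (expf_neq0 j x0)).
have resb : residue b = - m%:R.
  have -> : residue b = (map_poly (@residue E G v) B)`_j by rewrite coef_map.
  rewrite (map_prod_XsubC (@residue E G v)) -(coef_unipotent N char_p m0) -dE; congr (_`_j).
  rewrite big_seq (eq_bigr (fun=> 'X - 1)) => [|r rrs].
    by rewrite -big_seq big_const_seq count_predT iter_mulr_1.
  congr ('X - _%:P); rewrite -[RHS]residue1; apply/residue_val_eq.
  by rewrite insubd_val ?(rsP r rrs).1 // (rsP r rrs).2.
have mu : ~~ vpos (- m%:R).
  by rewrite vposN vpos_nat -prime_coprime // pchar_prime.
have mn0 : - m%:R != 0 :> E by apply: contraNneq mu => ->; exact: vpos0.
have mb : rv (- m%:R) (val b).
  apply: rv_unit => //; apply/(res_eq (vnneg_val b)); first by rewrite vnnegN vnneg_nat.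
  by rewrite res_val resb resN ?vnneg_nat // res_nat.
exists N, (F`_j / - m%:R).
  apply: (subringM K_ring); first exact: ((polyOver_setP K_ring F).2 FK).
  by apply: subfieldV => //; apply: (subringN K_ring); exact: (subring_nat K_ring).
rewrite Fj -mulrA -[X in rv _ X]mulr1; apply: rvM; first exact: rv_refl.
rewrite -[X in rv _ X](divff mn0); apply: rvM; [exact: rv_sym|exact: rv_refl].
Qed.

Lemma purely_wild_rv M (s : aut) x : purely_wild p v K M -> M x -> rv x (s x).
Proof. by move=> /purely_wildP[_ _ Mw] /Mw; exact: wild_element_rv. Qed.

Lemma maximal_purely_wild_above M : purely_wild p v K M ->
  exists W, maximal_purely_wild p v K W /\ M `<=` W.
Proof.
move=> /purely_wildP[M_field KM Mw].
have [W [Wr MW Ww Wmax]] := maximal_subring (subfield_subring M_field) Mw.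
have KW := subset_trans KM MW.
exists W; split=> //; split.
  apply/purely_wildP; split=> //; exact: (subring_subfield K_field K_alg).
move=> W' /purely_wildP[W'_field _ W'w] WW'; apply/seteqP; split=> //.
exact: (Wmax _ (subfield_subring W'_field)).
Qed.

End PurelyWild.

(** * Linear disjointness and commutators *)
Section LinearDisjointness.
Variables (E : closedFieldType) (K L F : set E).
Hypothesis F_field : is_subfield F.
Hypothesis L_fixed : forall x, F x ->
  (forall s : gal (@setT E) K, (forall y, L y -> s y = y) -> s x = x) -> L x.
Hypothesis F_stable : forall (s : gal (@setT E) K) x,
  (forall y, L y -> s y = y) -> F x -> F (s x).

(** Induction on the number of nonzero coefficients of a relation. With one coefficient
    normalised to 1, applying an automorphism over L and subtracting shortens the
    relation; hence all coefficients are fixed, and they lie in L and F, so in K. *)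
Lemma meet_of_not_linearly_disjoint : ~ linearly_disjoint K L F ->
  exists c, [/\ F c, L c & ~ K c].
Proof.
move=> notdisj; apply: contrapT => nomeet; apply: notdisj => n x Lx xfree.
have meet c : F c -> L c -> K c.
  by move=> Fc Lc; apply: contrapT => nKc; apply: nomeet; exists c.
have F_ring := subfield_subring F_field.
suff main (m : nat) (c : 'I_n -> E) : (#|[pred i | c i != 0%R]| <= m)%N -> (forall i, F (c i)) ->
    \sum_(i < n) c i * x i = 0 -> forall i, c i = 0.
  by move=> c Fc; apply: (main #|[pred i | c i != 0%R]|).
elim: m c => [|m IHm] c sc Fc cx i.
  apply/eqP; apply: contraTT sc => ci; rewrite -ltnNge.
  by apply/card_gt0P; exists i.
apply/eqP; apply: contraT => ci0; pose c' j := c j / c i.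
have Fc' j : F (c' j) by apply: (subringM F_ring) => //; exact: subfieldV.
have c'x : \sum_(j < n) c' j * x j = 0.
  rewrite (eq_bigr (fun j => (c i)^-1 * (c j * x j))) => [|j _].
    by rewrite -mulr_sumr cx mulr0.
  by rewrite /c' mulrAC mulrC.
have Lc' j : L (c' j).
  apply: L_fixed => // s sL; apply/eqP; rewrite -subr_eq0; apply/eqP.
  (* The coefficient with index i drops out, since c' i = 1. *)
  apply: (IHm (fun j => s (c' j) - c' j)) => [|k|].
  - rewrite -ltnS; apply: leq_trans sc; apply: proper_card; apply/properP; split.
      apply/fintype.subsetP => k; rewrite !inE; apply: contraNneq => ck0.
      by rewrite /c' ck0 mul0r rmorph0 subrr.
    by exists i; rewrite !inE // /c' divff // rmorph1 subrr eqxx.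
  - by apply: (subringB F_ring) => //; exact: F_stable.
  - rewrite (eq_bigr (fun k => s (c' k * x k) - c' k * x k)) => [|k _].
      by rewrite sumrB -rmorph_sum c'x rmorph0 subrr.
    by rewrite (rmorphM s (c' k)) /= (sL (x k)) // mulrBl.
have := xfree c' (fun j => meet _ (Fc' j) (Lc' j)) c'x i.
by rewrite /c' divff // => /eqP; rewrite oner_eq0.
Qed.

End LinearDisjointness.

Section CommutatorField.
Variables (p : nat) (E : closedFieldType) (G : orderedAbGroupType).
Variables (v : valuation E G) (K L : set E).
Hypothesis K_field : is_subfield K.
Hypothesis K_alg : forall x : E, algebraic_over K x.
Hypothesis K_hens : henselian v K.
Hypothesis char_p : p \in [pchar (residue_field v)].
Hypotheses (L_sep : L `<=` separable_closure K) (L_wild : purely_wild p v K L).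
Local Notation rv := (rv v).
Local Notation aut := (gal (@setT E) K).
Local Notation Ksep := (separable_closure K).
Let Gr := ramification_group v K.
Let H := gal_over Ksep K L.
Let C := commutator_subgroup Gr H.
Let F := fixed_field C.
Let KL : K `<=` L. Proof. by case: L_wild. Qed.
Let L_field : is_subfield L. Proof. by case: L_wild. Qed.
Let res (s : aut) : gal Ksep K := sep_restrict K_field K_alg s.

Lemma restrictE (s : aut) x : Ksep x -> res s x = s x.
Proof. exact: restrict_funE. Qed.

Lemma restrict_inv (s : aut) x : Ksep x -> ((res s)^-1)%g x = gal_inv s x.
Proof.
move=> xs; apply: (@gal_inj _ _ _ (res s)); rewrite [LHS]gal_invK restrictE.
  by rewrite /= gal_invK.
exact: separable_aut.
Qed.

Lemma subfield_separable : K `<=` Ksep.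
Proof.
move=> k Kk; apply: (@separable_overP _ _ K_field K_alg k ('X - k%:P)).
- have K_ring := subfield_subring K_field; apply/(polyOver_setP K_ring) => i.
  rewrite coefB coefX coefC; apply: (subringB K_ring).
    exact: (subring_nat K_ring).
  by case: eqP => // _; exact: (subring0 K_ring).
- by have := separable_prod_XsubC [:: k]; rewrite big_seq1.
- by rewrite root_XsubC.
Qed.

Lemma separable_closure_subfield : is_subfield Ksep.
Proof.
apply: (subring_subfield K_field K_alg); last exact: subfield_separable.
have K_ring := subfield_subring K_field.
apply: subringP; split=> [|x y xs ys|x y].
- by apply: subfield_separable; exact: (subring1 K_ring).
- apply: separableD => //; rewrite -mulN1r; apply: separableM => //.
  by apply/subfield_separable/(subringN K_ring)/(subring1 K_ring).
- exact: separableM.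
Qed.

Lemma fixed_field_subfield (A : set (gal Ksep K)) : is_subfield (fixed_field A).
Proof.
have S_ring := subfield_subring separable_closure_subfield.
apply: (subring_subfield K_field K_alg); last first.
  by move=> x Kx; split=> [|s _]; [exact: subfield_separable|case: (gal_iso s) => _ _ _; apply].
apply: subringP; split=> [|x y [xs xA] [ys yA]|x y [xs xA] [ys yA]].
- split=> [|s _]; first exact: (subring1 S_ring).
  by case: (gal_iso s) => _ _ _; apply; exact: (subring1 (subfield_subring K_field)).
- have xys : Ksep (x - y) by exact: (subringB S_ring).
  split=> // s As; case: (gal_iso s) => _ sD _ _.
  have : s (x - y) + s y = x by rewrite -sD // subrK xA.
  by rewrite (yA _ As) => /(canRL (addrK y)).
- have xys : Ksep (x * y) by exact: (subringM S_ring).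
  by split=> // s As; case: (gal_iso s) => _ _ sM _; rewrite sM // xA // yA.
Qed.

Lemma ramification_groupP (s : gal Ksep K) : Gr s <-> forall x, Ksep x -> rv x (s x).
Proof.
split=> [sr x xs|sr x xs x0]; last by apply/rvP => //; exact: sr.
have [->|x0] := eqVneq x 0; last by apply/rvP => //; exact: sr.
have -> : s 0 = 0.
  by case: (gal_iso s) => _ _ _; apply; exact: (subring0 (subfield_subring K_field)).
exact: rv_refl.
Qed.

Lemma restrict_ramified (s : aut) : ramified v s -> Gr (res s).
Proof. by move=> sr; apply/ramification_groupP => x xs; rewrite restrictE. Qed.

Lemma restrict_over (s : aut) : (forall x, L x -> s x = x) -> H (res s).
Proof. by move=> sL x Lx; rewrite restrictE ?sL //; exact: L_sep. Qed.

Lemma ramification_group_conj (s : aut) (g : gal Ksep K) : Gr g ->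
  Gr ((res s)^-1 * g * res s)%g.
Proof.
move=> /ramification_groupP gr; apply/ramification_groupP => x xs.
have sxs : Ksep (s x) by exact: separable_aut.
have -> : ((res s)^-1 * g * res s)%g x = gal_inv s (g (s x)).
  rewrite -[LHS]/(((res s)^-1)%g (g (res s x))) restrictE // restrict_inv //.
  exact: gal_stable.
have := aut_rv K_hens (gal_inv s) (gr _ sxs).
by rewrite /= galK.
Qed.

Lemma over_conj (s : aut) (h : gal Ksep K) : (forall x, L x -> s x = x) -> H h ->
  H ((res s)^-1 * h * res s)%g.
Proof.
move=> sL hH x Lx; have xs := L_sep Lx.
rewrite -[LHS]/(((res s)^-1)%g (h (res s x))) restrictE // sL // hH // restrict_inv //.
by rewrite -{1}(sL x Lx) /= galK.
Qed.

(** Conjugation by an automorphism over L preserves the two sets of which the commutators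
    are formed. *)
Lemma commutator_conj (s : aut) (t : gal Ksep K) : (forall x, L x -> s x = x) ->
  C t -> C ((res s)^-1 * t * res s)%g.
Proof.
move=> sL Ct M [Mg genM].
pose M' := [set u : gal Ksep K | M ((res s)^-1 * u * res s)%g].
apply: (Ct M'); split.
  case: Mg => /set_mem M1 Mdiv; split; first by apply/mem_set; rewrite /M' /= mulg1 mulVg.
  move=> a b /set_mem /= Ma /set_mem /= Mb; apply/mem_set => /=.
  have := Mdiv _ _ (mem_set Ma) (mem_set Mb) => /set_mem.
  by rewrite /M' /= !invgM invgK !mulgA mulgK.
move=> _ [g Gg [h Hh <-]] /=; apply: genM.
exists ((res s)^-1 * g * res s)%g; first exact: ramification_group_conj.
exists ((res s)^-1 * h * res s)%g; first exact: over_conj.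
by rewrite !invgM !invgK !mulgA !mulgK.
Qed.

Lemma commutator_field_stable (s : aut) x : (forall y, L y -> s y = y) -> F x -> F (s x).
Proof.
move=> sL [xs xC]; split; first exact: separable_aut.
move=> t Ct; apply: (@gal_inj _ _ _ (gal_inv s)).
rewrite {2}/gal_inv /= galK -[RHS](xC _ (commutator_conj sL Ct)).
rewrite -[RHS]/(((res s)^-1)%g (t (res s x))) restrictE // restrict_inv //.
by apply: gal_stable; exact: separable_aut.
Qed.

(** On L the automorphism s agrees with a ramified n. For h over L, the commutator of
    the inverse of n with h fixes c, so h fixes n c; thus n c lies in L. *)
Lemma conjugates_of_commutator_fixed c (s : aut) : F c -> L c -> L (s c).
Proof.
move=> [cs cC] Lc.
have [n [nr nL]] := ramified_extension K_field K_alg K_hens L_field KL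
  (fun x Lx => purely_wild_rv K_field K_hens char_p s L_wild Lx).
rewrite -nL //; apply: contrapT => nLnc.
have ncs : Ksep (n c) by exact: separable_aut.
have [h [hL hnc]] := moved_by_aut K_field K_alg L_field KL ncs nLnc.
pose g := res (gal_inv n).
have Cgh : C (g * res h * g^-1 * (res h)^-1)%g.
  move=> M [_ genM]; apply: genM; exists g.
    by apply: restrict_ramified; exact: ramifiedV.
  by exists (res h) => //; exact: restrict_over.
have := cC _ Cgh; rewrite -[LHS]/(g (res h (g^-1 ((res h)^-1 c))))%g.
have -> : ((res h)^-1)%g c = c.
  by rewrite restrict_inv // -{1}(hL c Lc) /= galK.
have gnc : g (n c) = c by rewrite /g restrictE // /= galK.
have -> : (g^-1)%g c = n c by rewrite -{1}gnc [LHS]galK.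
by move=> e; have := gal_inj (etrans e (esym gnc)); rewrite restrictE.
Qed.

Lemma normal_element : ~ linearly_disjoint K L F ->
  exists c, [/\ L c, ~ K c & forall s : aut, L (s c)].
Proof.
move/(meet_of_not_linearly_disjoint (fixed_field_subfield C)) => [||c [Fc Lc Kc]].
- move=> x [xs _] xfix; apply: contrapT => nLx.
  have [s [sL sx]] := moved_by_aut K_field K_alg L_field KL xs nLx.
  by apply: sx; exact: xfix.
- exact: commutator_field_stable.
- by exists c; split=> // s; exact: conjugates_of_commutator_fixed.
Qed.

End CommutatorField.

(** * Conjugates of an Artin-Schreier root *)
Lemma periodic_sum (V : nmodType) n l (f : nat -> V) : (forall i, f (i + n)%N = f i) ->
  \sum_(i < n) f (i + l)%N = \sum_(i < n) f i.
Proof.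
move=> fn; elim: l => [|l IHl]; first by apply: eq_bigr => i _; rewrite addn0.
rewrite -{}IHl; case: n fn => [|n] fn; first by rewrite !big_ord0.
rewrite big_ord_recr [RHS]big_ord_recl /= addrC.
rewrite addnS -addSn addnC fn add0n; congr (_ + _).
by apply: eq_bigr => i _; rewrite /= /bump /= addnS.
Qed.

Lemma natr_pchar_inj (k : fieldType) p i j : p \in [pchar k] -> (i < p)%N -> (j < p)%N ->
  i%:R = j%:R :> k -> i = j.
Proof.
move=> kp ip jp.
wlog ij : i j ip jp / (i <= j)%N.
  by move=> W; case/orP: (leq_total i j) => h e; [|apply/esym]; apply: W.
move=> e; have : (j - i)%:R == 0 :> k by rewrite natrB // e subrr.
rewrite -(dvdn_pcharf kp) => /dvdnP[[|m] jiE].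
  by apply/eqP; rewrite eqn_leq ij -subn_eq0 jiE.
by move: (leq_ltn_trans (leq_subr i j) jp); rewrite jiE mulSn ltnNge leq_addr.
Qed.

Lemma frobenius_fixed (k : fieldType) p (d : k) : p \in [pchar k] -> d ^+ p = d ->
  exists i, d = i%:R.
Proof.
move=> kp dp; have pp := pcharf_prime kp; apply: contrapT => nat_d.
pose q : {poly k} := 'X^p - 'X.
have sq : size q = p.+1.
  by rewrite size_polyDl size_polyXn // size_polyN size_polyX ltnS prime_gt1.
have q0 : q != 0 by rewrite -size_poly_eq0 sq.
have qroot x : root q x = (x ^+ p == x).
  by rewrite /root !hornerE subr_eq0.
have /(max_poly_roots q0) : all (root q) (d :: [seq i%:R | i <- iota 0 p]).
  rewrite /= qroot dp eqxx /=; apply/allP => _ /mapP[i _ ->].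
  by rewrite qroot -[_ ^+ _]/(pFrobenius_aut kp i%:R) rmorph_nat.
rewrite /= size_map size_iota sq ltnn.
have -> : d \notin [seq i%:R | i <- iota 0 p].
  by apply/mapP => -[i _ di]; apply: nat_d; exists i.
rewrite map_inj_in_uniq ?iota_uniq => [/(_ isT)//|i j].
rewrite !mem_iota !add0n /= => ip jp.
exact: (natr_pchar_inj kp).
Qed.

Section ArtinSchreier.
Variables (p : nat) (E : closedFieldType) (G : orderedAbGroupType).
Variables (v : valuation E G) (K : set E).
Hypothesis K_field : is_subfield K.
Hypothesis K_alg : forall x : E, algebraic_over K x.
Hypothesis K_hens : henselian v K.
Hypothesis char_p : p \in [pchar (residue_field v)].
Local Notation rv := (rv v).
Local Notation vpos := (vpos v).
Local Notation vnneg := (vnneg v).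
Local Notation aut := (gal (@setT E) K).
Local Notation res := (res v).
Local Notation Kv := (residue_subfield v K).

Let K_ring := subfield_subring K_field.
Let p_prime : prime p := pchar_prime char_p.
Let p_gt0 : (0 < p)%N := prime_gt0 p_prime.

Lemma residue_subfieldP a : Kv a <-> exists2 x, K x /\ vnneg x & a = res x.
Proof.
split=> [[w Kw <-]|[x [Kx xi] ->]].
  by exists (val w); [split=> //; exact: vnneg_val|rewrite res_val].
by exists (insubd 0 x) => //=; rewrite insubd_val.
Qed.

Lemma residue_subfield_ring : subring_closed (mem Kv).
Proof.
apply: subringP; split.
- apply/residue_subfieldP; exists 1; last by rewrite res1.
  by split; [exact: (subring1 K_ring)|exact: vnneg1].
- move=> _ _ /residue_subfieldP[x [Kx xi] ->] /residue_subfieldP[y [Ky yi] ->].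
  apply/residue_subfieldP; exists (x - y); last by rewrite resB.
  by split; [exact: (subringB K_ring)|apply: vnnegD; rewrite ?vnnegN].
- move=> _ _ /residue_subfieldP[x [Kx xi] ->] /residue_subfieldP[y [Ky yi] ->].
  apply/residue_subfieldP; exists (x * y); last by rewrite resM.
  by split; [exact: (subringM K_ring)|exact: vnnegM].
Qed.

(** Let theta be a root of X^p - X - k, where k lifts a constant for which the
    Artin-Schreier polynomial is irreducible. The roots of X^p - X - k are told apart
    by their residues, which differ by elements of the prime field. So automorphisms
    shift the roots cyclically, and ramified ones fix them. Not all automorphisms fix
    theta: otherwise all conjugates of theta would have its leading term, and the residue
    of theta would be purely inseparable over the residue field of K. The t i are the
    iterates of one automorphism that moves theta. *)
Lemma artin_schreier_orbit : ~ artin_schreier_closed p Kv -> exists t : nat -> E,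
  [/\ forall s : aut, exists l, forall i, s (t i) = t (i + l)%N,
      exists s : aut, forall i, s (t i) = t i.+1,
      forall i, t (i + p)%N = t i,
      forall i j, (i < p)%N -> (j < p)%N -> t i = t j -> i = j &
      forall (n : aut) i, ramified v n -> n (t i) = t i].
Proof.
move=> notclosed.
have [a [Kva airr]] : exists a, Kv a /\ irreducible_over Kv ('X^p - 'X - a%:P).
  apply: contrapT => h; apply: notclosed => a Ka irr; apply: h; by exists a.
have [k [Kk ki] aE] := (residue_subfieldP a).1 Kva.
have aut_nneg (s : aut) x : vnneg x -> vnneg (s x) by rewrite (aut_vnneg K_hens).
have aut_res (s : aut) x y : vnneg x -> vnneg y -> res x = res y -> res (s x) = res (s y).
  move=> xi yi /(res_eq xi yi) xy; apply/res_eq; [exact: aut_nneg|exact: aut_nneg|].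
  by rewrite -rmorphB (aut_vpos K_hens).
have size_as (R : comNzRingType) (b : R) : size ('X^p - 'X - b%:P : {poly R}) = p.+1.
  rewrite -addrA -opprD size_polyDl size_polyXn // size_polyN size_polyDl size_polyX.
    by rewrite ltnS prime_gt1.
  by rewrite size_polyC; case: eqP.
(* A root in the residue field of K would give a linear factor. *)
have noroot b : Kv b -> b ^+ p != b + a.
  move=> Kvb; apply/eqP => bp; have [_ _ irr] := airr.
  have Xb : 'X - b%:P \is a polyOver (mem Kv).
    apply/(polyOver_setP residue_subfield_ring) => i; rewrite coefB coefX coefC.
    apply: (subringB residue_subfield_ring); first exact: (subring_nat residue_subfield_ring).
    by case: eqP => // _; exact: (subring0 residue_subfield_ring).
  have := irr _ Xb; rewrite size_XsubC dvdp_XsubCl => /(_ isT).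
  have -> : root ('X^p - 'X - a%:P) b.
    by apply/rootP; rewrite !hornerE bp -addrA -opprD subrr.
  move=> /(_ isT) /eqp_size e.
  have [p1] := etrans (esym (size_XsubC b)) (etrans e (size_as _ a)).
  by have := prime_gt1 p_prime; rewrite -p1.
have [theta theta_root] : exists theta : E, root ('X^p - 'X - k%:P) theta.
  by apply/closed_rootP; rewrite size_as eqSS -lt0n.
have theta_p : theta ^+ p = theta + k.
  apply/eqP; rewrite -subr_eq0 opprD addrA.
  by move/rootP: theta_root; rewrite !hornerE => ->.
have theta_i : vnneg theta.
  have [//|nti] := boolP (vnneg theta); have ti := vposV nti.
  have t0 : theta != 0 by apply: contraNneq nti => ->; exact: vnneg0.
  have : 1 = theta^-1 ^+ p.-1 + k * theta^-1 ^+ p.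
    have pS : theta ^+ p = theta ^+ p.-1 * theta by rewrite -exprSr prednK.
    apply: (mulIf (expf_neq0 p t0)); rewrite mul1r mulrDl -mulrA -exprMn mulVf //.
    rewrite expr1n mulr1 {1}theta_p; congr (_ + _).
    by rewrite pS mulrA -exprMn mulVf // expr1n mul1r.
  move=> e; have := vpos1 v; rewrite e => /negP[].
  have p1 : (0 < p.-1)%N by rewrite -ltnS prednK // prime_gt1.
  by apply: vposD; [exact: vpos_exp|apply: vposMl => //; exact: vpos_exp].
pose is_conj x := vnneg x /\ x ^+ p = x + k.
have conj_uniq x y : is_conj x -> is_conj y -> res x = res y -> x = y.
  move=> [xi xp] [yi yp] xy; apply/eqP; rewrite -subr_eq0; apply: contraT => xy0.
  have := subrXX x y p; rewrite xp yp opprD addrACA subrr addr0.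
  rewrite -{1}[x - y]mulr1 => /(mulfI xy0) one.
  (* The cofactor of x - y has residue p (res x)^(p-1) = 0, so it is not 1. *)
  have resS (f : 'I_p -> E) (r : seq 'I_p) : (forall i, vnneg (f i)) ->
      vnneg (\sum_(i <- r) f i) /\ res (\sum_(i <- r) f i) = \sum_(i <- r) res (f i).
    move=> fi; elim: r => [|i r [ri IHr]].
      by rewrite !big_nil; split; [exact: vnneg0|exact: res0].
    rewrite !big_cons; split; first exact: vnnegD.
    by rewrite (resD (fi i) ri) IHr.
  have [|_ e] := resS (fun i : 'I_p => x ^+ (p.-1 - i) * y ^+ i) (index_enum 'I_p).
    by move=> i; apply: vnnegM; exact: vnnegX.
  move: e; rewrite -one res1.
  rewrite (eq_bigr (fun=> res x ^+ p.-1)) => [|i _].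
    by rewrite sumr_const card_ord mulrn_pchar // => /eqP; rewrite oner_eq0.
  rewrite (resM (vnnegX _ xi) (vnnegX _ yi)) (resX _ xi) (resX _ yi) -xy -exprD.
  by rewrite subnK // -ltnS prednK.
have conj_aut (s : aut) x : is_conj x -> is_conj (s x).
  by move=> [xi xp]; split; [exact: aut_nneg|rewrite -rmorphXn xp rmorphD /= (aut_fix s Kk)].
have theta_conj : is_conj theta by [].
pose rho := res theta.
have rho_p : rho ^+ p = rho + a by rewrite /rho -resX // theta_p aE resD.
have rho_Kv : ~ Kv rho by move/noroot; rewrite rho_p eqxx.
have rho_wild N : ~ Kv (rho ^+ (p ^ N)).
  elim: N => [|N IHN]; first by rewrite expn0 expr1.
  have pnatN : [pchar (residue_field v)].-nat (p ^ N)%N by rewrite pnatX pnatE // char_p.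
  rewrite expnS exprM rho_p (exprDn_pchar _ _ pnatN) => h; apply: IHN.
  rewrite -[X in Kv X](addrK (a ^+ (p ^ N))).
  by apply: (subringB residue_subfield_ring) => //; exact: (subringX residue_subfield_ring).
have [s0 s0_moves] : exists s : aut, res (s theta) != rho.
  apply: contrapT => nomove; apply: rho_Kv.
  have fixd (s : aut) : res (s theta) = rho.
    by apply/eqP; apply: contrapT => /negP h; apply: nomove; exists s.
  have [theta_pos|theta_u] := boolP (vpos theta).
    by rewrite /rho ((res_eq0 theta_i).2 theta_pos); exact: (subring0 residue_subfield_ring).
  have [s|N [b Kb bt]] := wild_element_of_rv K_field K_alg char_p (x := theta).
    by apply: rv_unit => //; apply/res_eq; [exact: aut_nneg| |exact: fixd].
  case: (rho_wild N); rewrite /rho -resX //.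
  have tN : vnneg (theta ^+ (p ^ N)) by exact: vnnegX.
  have bi : vnneg b := rv_vnneg (rv_sym bt) tN.
  apply/residue_subfieldP; exists b => //.
  by apply/res_eq => //; exact: rv_vpos_sub.
have diff_fixed (s : aut) : (res (s theta) - rho) ^+ p = res (s theta) - rho.
  rewrite -[LHS]/(pFrobenius_aut char_p (res (s theta) - rho)) rmorphB /= !pFrobenius_autE rho_p.
  rewrite -(resX _ (aut_nneg s _ theta_i)) -rmorphXn theta_p rmorphD /= (aut_fix s Kk).
  by rewrite (resD (aut_nneg s _ theta_i) ki) aE opprD addrACA subrr addr0.
pose d0 := res (s0 theta) - rho.
have d00 : d0 != 0 by rewrite subr_eq0.
(* Being in the prime field, d0 lifts to a natural number, fixed by automorphisms. *)
have [j0 d0E] := frobenius_fixed char_p (diff_fixed s0 : d0 ^+ p = d0).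
pose t i := iter i s0 theta.
have t_conj i : is_conj (t i) by elim: i => //= i; exact: conj_aut.
have res_aut_t (s : aut) i : res (t i) = rho + d0 *+ i ->
    res (s (t i)) = res (s theta) + d0 *+ i.
  move=> e; have ji : vnneg (j0 * i)%:R by exact: vnneg_nat.
  rewrite (aut_res s (t i) (theta + (j0 * i)%:R)) ?(t_conj i).1 ?vnnegD //.
    rewrite rmorphD rmorph_nat (resD (aut_nneg s _ theta_i) ji) res_nat natrM -d0E.
    by rewrite mulr_natr.
  by rewrite (resD theta_i ji) res_nat natrM -d0E mulr_natr.
have res_t i : res (t i) = rho + d0 *+ i.
  elim: i => [|i IHi]; first by rewrite mulr0n addr0.
  rewrite /= (res_aut_t s0 i IHi) mulrS addrA; congr (_ + _).
  by rewrite addrC subrK.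
have d0p : d0 *+ p = 0 by rewrite mulrn_pchar.
exists t; split.
- move=> s; have [l lE] : exists l, (res (s theta) - rho) / d0 = l%:R.
    by apply: (frobenius_fixed char_p); rewrite expr_div_n !diff_fixed.
  exists l => i; apply: conj_uniq => //; first exact: conj_aut.
  rewrite res_aut_t // res_t mulrnDr addrCA addrC; congr (_ + _).
  by rewrite -mulr_natr -lE mulrCA divff // mulr1 addrC subrK.
- by exists s0.
- by move=> i; apply: conj_uniq => //; rewrite !res_t mulrnDr d0p addr0.
- move=> i j ip jp /(congr1 res); rewrite !res_t => /addrI.
  rewrite -[d0 *+ i]mulr_natr -[d0 *+ j]mulr_natr => /(mulfI d00).
  exact: (natr_pchar_inj char_p).
- move=> n i nr; apply: conj_uniq => //; first exact: conj_aut.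
  have [ti _] := t_conj i.
  by apply/res_eq => //; [exact: aut_nneg|exact: rv_vpos_sub].
Qed.

End ArtinSchreier.

(** * Incompatible purely wild extensions *)
Section TwistedField.
Variables (p : nat) (E : closedFieldType) (G : orderedAbGroupType).
Variables (v : valuation E G) (K : set E).
Hypothesis K_field : is_subfield K.
Hypothesis K_alg : forall x : E, algebraic_over K x.
Hypothesis K_hens : henselian v K.
Hypothesis char_p : p \in [pchar (residue_field v)].
Local Notation rv := (rv v).
Local Notation vpos := (vpos v).
Local Notation aut := (gal (@setT E) K).

Let p_prime : prime p := pchar_prime char_p.

Lemma iter_aut (s : aut) m : exists g : aut, forall x, g x = iter m s x.
Proof.
elim: m => [|m [g gE]]; first by exists (gal1 _ _).
by exists (gal_mul s g) => x; rewrite /= gE.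
Qed.

Lemma finite_orbit (s : aut) c : exists2 n, (0 < n)%N & iter n s c = c.
Proof.
have [q [qK q0 qc]] := K_alg c; have [rs qE] := closed_field_poly_normal q.
have orb i : iter i s c \in rs.
  have qi : root q (iter i s c).
    elim: i => //= i /rootP qi; apply/rootP.
    by rewrite -(aut_horner s _ K_field qK) qi rmorph0.
  by move: qi; rewrite {1}qE rootZ ?lead_coef_eq0 // root_prod_XsubC.
have [i [j [ij e]]] : exists i j, (i < j)%N /\ iter i s c = iter j s c.
  have : ~~ uniq [seq iter i s c | i <- iota 0 (size rs).+1].
    apply/negP => u.
    have /(uniq_leq_size u) : {subset [seq iter i s c | i <- iota 0 (size rs).+1] <= rs}.
      by move=> _ /mapP[i _ ->].
    by rewrite size_map size_iota ltnn.
  case/(uniqPn 0) => i [j [ij]]; rewrite size_map size_iota => jn.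
  rewrite !(nth_map 0%N) ?size_iota ?(ltn_trans ij jn) //.
  rewrite !nth_iota ?(ltn_trans ij jn) // !add0n => e.
  by exists i, j.
exists (j - i)%N; first by rewrite subn_gt0.
have iter_inj m : injective (iter m s).
  by elim: m => [|m IHm] x y //= /gal_inj /IHm.
by apply: (iter_inj i); rewrite -iterD addnC subnK ?e // ltnW.
Qed.

(** Let s move c, with an orbit of length n. If p divides n, a power of s has an orbit of
    length p at c. Otherwise let d be the difference of n c and the sum T of the orbit.
    The sum of the conjugates of d vanishes; they all have the leading term of d, so it
    also has the leading term of n d, and d = 0. But then c is fixed. *)
Lemma order_p_aut (L : set E) c : purely_wild p v K L -> separable_over K c ->
  ~ K c -> (forall s : aut, L (s c)) ->
  exists g : aut, iter p g c = c /\ g c <> c.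
Proof.
move=> Lw c_sep Kc Lsc; have [L_field KL _ _] := Lw; have L_ring := subfield_subring L_field.
have [s [_ sc]] := moved_by_aut K_field K_alg K_field (@subset_refl _ K) c_sep Kc.
have exn : exists n, (0 < n)%N && (iter n s c == c).
  by have [n n0 nc] := finite_orbit s c; exists n; rewrite n0 nc eqxx.
have [n /andP[n0 /eqP nc] nmin] := ex_minnP exn.
have Lit i : L (iter i s c) by have [g <-] := iter_aut s i.
have [pn|npn] := boolP (p %| n)%N.
  have [g gE] := iter_aut s (n %/ p); exists g; split.
    have -> : iter p g c = iter p (iter (n %/ p) s) c by exact: eq_iter.
    by rewrite -iterM mulnC divnK.
  rewrite gE => /eqP e; have := nmin (n %/ p)%N; rewrite e andbT divn_gt0 ?prime_gt0 //.
  move=> /(_ (dvdn_leq n0 pn)); rewrite leqNgt ltn_Pdiv //; exact: prime_gt1.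
exfalso; pose T := \sum_(i < n) iter i s c.
have sT : s T = T.
  rewrite rmorph_sum -[RHS](periodic_sum 1 (f := fun i => iter i s c)).
    by apply: eq_bigr => i _; rewrite addn1.
  by move=> i; rewrite iterD nc.
have n_unit : ~~ vpos n%:R by rewrite (vpos_nat char_p).
have nE0 : n%:R != 0 :> E by apply: contraNneq n_unit => ->; exact: vpos0.
pose d := c * n%:R - T.
have Ld : L d.
  apply: (subringB L_ring); last by apply: (subring_sum L_ring) => i _.
  by apply: (subringM L_ring); [exact: (Lit 0%N)|exact: (subring_nat L_ring)].
have sd j : iter j s d = iter j s c * n%:R - T.
  by elim: j => //= j ->; rewrite rmorphB rmorphM rmorph_nat /= sT.
have sumd : \sum_(j < n) iter j s d = 0.
  rewrite (eq_bigr (fun j : 'I_n => iter j s c * n%:R - T)) => [|j _]; last exact: sd.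
  by rewrite sumrB -mulr_suml sumr_const card_ord mulr_natr subrr.
have d0 : d = 0.
  have term j : exists u, vpos u /\ iter j s d = d * (1 + u).
    have [g gE] := iter_aut s j.
    have [u ui e] := purely_wild_rv K_field K_hens char_p g Lw Ld.
    by exists u; rewrite -gE.
  pose u j := sval (cid (term j)).
  have uP j : vpos (u j) /\ iter j s d = d * (1 + u j) by rewrite /u; case: cid.
  move: sumd; rewrite (eq_bigr (fun j : 'I_n => d * (1 + u j))) => [|j _]; last exact: (uP j).2.
  rewrite -mulr_sumr big_split /= sumr_const card_ord => /eqP.
  rewrite mulf_eq0 => /orP[/eqP//|/eqP e]; case/negP: n_unit.
  rewrite -[n%:R](addrK (\sum_(i < n) u i)) e sub0r vposN.
  by apply: vpos_sum => i _; exact: (uP i).1.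
apply: sc; apply: (mulIf nE0); have cT : c * n%:R = T by apply/eqP; rewrite -subr_eq0 -d0.
by have := sT; rewrite -cT rmorphM rmorph_nat.
Qed.

(** Applying s to the power sums and comparing gives a linear relation among the powers of
    the t i with coefficients c (i - 1) - c i. Evaluating it at the polynomial that
    vanishes at all t i except t 1 isolates one coefficient. *)
Lemma twisted_power_sums (n : nat) (c t : nat -> E) (W : set E) (s : aut) :
  (forall i, c (i + n)%N = c i) -> (forall i, t (i + n)%N = t i) ->
  (forall i j, (i < n)%N -> (j < n)%N -> t i = t j -> i = j) -> (1 < n)%N ->
  (forall x, W x -> s x = x) -> (forall i, s (t i) = t i.+1) ->
  (forall i, W (c i)) -> (forall j, W (\sum_(i < n) c i * t i ^+ j)) -> c 1%N = c 0%N.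
Proof.
move=> c_per t_per t_inj n1 sW st Wc Wm.
(* Modulo n, the index i + n.-1 is i - 1. *)
pose e i := c (i + n.-1)%N - c i.
have pow j : \sum_(i < n) e i * t i ^+ j = 0.
  rewrite (eq_bigr (fun i : 'I_n => c (i + n.-1)%N * t i ^+ j - c i * t i ^+ j)) => [|i _].
    rewrite sumrB -[X in _ - X](sW _ (Wm j)) rmorph_sum /=.
    rewrite -(periodic_sum 1 (f := fun i => c (i + n.-1)%N * t i ^+ j)); last first.
      by move=> i; rewrite t_per addnAC c_per.
    apply/eqP; rewrite subr_eq0; apply/eqP; apply: eq_bigr => i _.
    by rewrite rmorphM rmorphXn /= sW // st -addnA add1n (ltn_predK n1) c_per addn1.
  by rewrite mulrBl.
pose Q := \prod_(j < n | j != 1%N :> nat) ('X - (t j)%:P).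
have eQ : \sum_(i < n) e i * Q.[t i] = 0.
  rewrite (eq_bigr (fun i : 'I_n => \sum_(j < size Q) Q`_j * (e i * t i ^+ j))) => [|i _].
    by rewrite exchange_big big1 // => j _; rewrite -mulr_sumr pow mulr0.
  by rewrite horner_coef mulr_sumr; apply: eq_bigr => j _; rewrite mulrCA.
move: eQ; rewrite (bigD1 (Ordinal n1)) //= big1 ?addr0 => [|i i1]; last first.
  rewrite (_ : Q.[t i] = 0) ?mulr0 //; apply/rootP.
  by rewrite /Q (bigD1 i) // rootM root_XsubC eqxx.
move/eqP; rewrite mulf_eq0 => /orP[|/eqP Q1].
  by rewrite /e add1n (ltn_predK n1) -[n]add0n c_per subr_eq0 => /eqP ->.
have /eqP[] : Q.[t 1%N] != 0; last exact: Q1.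
rewrite horner_prod; apply/prodf_neq0 => i i1.
rewrite hornerXsubC subr_eq0; apply: contra i1 => /eqP.
by move=> /(t_inj _ _ n1 (ltn_ord i)) <-.
Qed.

End TwistedField.

Section Incompatibility.
Variables (p : nat) (E : closedFieldType) (G : orderedAbGroupType).
Variables (v : valuation E G) (K L : set E).
Hypothesis K_field : is_subfield K.
Hypothesis K_alg : forall x : E, algebraic_over K x.
Hypothesis K_hens : henselian v K.
Hypothesis char_p : p \in [pchar (residue_field v)].
Hypothesis L_wild : purely_wild p v K L.
Hypothesis notclosed : ~ artin_schreier_closed p (residue_subfield v K).
Local Notation aut := (gal (@setT E) K).

(** Let M be the fixed field of the automorphisms which shift the t i and the iterates
    g^i c simultaneously. Every automorphism s becomes one of those after multiplication
    by a ramified one, because a ramified automorphism fixes the t i and can be prescribed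
    on L by [ramified_extension]. Hence s preserves the leading terms of M, so that M is
    purely wild. If W contains M and the g^i c, then it contains the power sums of
    [twisted_power_sums], and there is an automorphism over W which shifts the t i, again
    by [ramified_extension]; so g c = c, against the choice of g. *)
Lemma incompatible_purely_wild c : separable_over K c -> ~ K c ->
  (forall s : aut, L (s c)) -> exists M, purely_wild p v K M /\
  forall W, purely_wild p v K W -> M `<=` W -> ~ (forall s : aut, W (s c)).
Proof.
move=> c_sep Kc Lsc; have [L_field KL _ _] := L_wild.
have [g [gp gc]] := order_p_aut K_field K_alg K_hens char_p L_wild c_sep Kc Lsc.
have [t [t_aut [s1 s1t] t_per t_inj t_ram]] :=
  artin_schreier_orbit K_field K_alg K_hens char_p notclosed.
pose ci i := iter i g c.
have c_per i : ci (i + p)%N = ci i by rewrite /ci iterD gp.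
pose twist (s : aut) := exists l, forall i, s (t i) = t (i + l)%N /\ s (ci i) = ci (i + l)%N.
pose M := [set x | forall s : aut, twist s -> s x = x].
have M_ring : subring_closed (mem M).
  apply: subringP; split=> [s _|x y Mx My s ts|x y Mx My s ts].
  - by rewrite rmorph1.
  - by rewrite rmorphB /= Mx // My.
  - by rewrite rmorphM /= Mx // My.
have KM : K `<=` M by move=> k Kk s _; exact: aut_fix.
have M_field := subring_subfield K_field K_alg M_ring KM.
have M_wild : purely_wild p v K M.
  apply/(purely_wildP p v K_field M); split=> // x Mx.
  apply: (wild_element_of_rv K_field K_alg char_p) => s.
  have [l sl] := t_aut s; have [h hE] := iter_aut g l.
  have [n [nr nL]] := ramified_extension K_field K_alg K_hens L_field KL
    (fun x Lx => purely_wild_rv K_field K_hens char_p (gal_mul h (gal_inv s)) L_wild Lx).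
  (* n undoes s on the conjugates of c and then shifts by l; it fixes the t i. *)
  have ns : twist (gal_mul n s).
    exists l => i; have [f fE] := iter_aut g i; split; first by rewrite /= sl t_ram.
    rewrite /= nL; last by rewrite /ci -fE; exact: (Lsc (gal_mul s f)).
    by rewrite /= galK hE /ci addnC iterD.
  by have := nr (s x); rewrite -[n (s x)]/(gal_mul n s x) (Mx _ ns) => /rv_sym.
exists M; split=> // W W_wild MW Wc; have [W_field KW _ _] := W_wild.
have [n [nr nW]] := ramified_extension K_field K_alg K_hens W_field KW
  (fun x Wx => purely_wild_rv K_field K_hens char_p s1 W_wild Wx).
pose s : aut := gal_mul (gal_inv n) s1.
have sW x : W x -> s x = x by move=> Wx; rewrite /s /= -nW // galK.
have st i : s (t i) = t i.+1.
  have tW1 : n (t i.+1) = t i.+1 by exact: t_ram.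
  by rewrite /s /= s1t -{1}tW1 galK.
have p1 : (1 < p)%N := prime_gt1 (pchar_prime char_p).
apply: gc; apply: (twisted_power_sums c_per t_per t_inj p1 sW st) => [i|j].
  by rewrite /ci; have [f <-] := iter_aut g i; exact: Wc.
apply: MW => u [l ul]; rewrite rmorph_sum /=.
rewrite -[RHS](periodic_sum l (f := fun i => ci i * t i ^+ j)) => [|i].
  by apply: eq_bigr => i _; rewrite rmorphM rmorphXn /= (ul i).1 (ul i).2.
by rewrite c_per t_per.
Qed.

End Incompatibility.

Theorem theorem1p8 (p : nat) (Kac : closedFieldType) (G : orderedAbGroupType)
    (nu : valuation Kac G) (K L : set Kac)
    (K_field : is_subfield K) (L_field : is_subfield L) (KL : K `<=` L)
    (Kac_alg : forall x : Kac, algebraic_over K x)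
    (K_hens : henselian nu K) (L_hens : henselian nu L)
    (char_p : p \in [pchar (residue_field nu)])
    (L_nontrivial : L <> K)
    (L_sep : L `<=` separable_closure K)
    (L_wild : purely_wild p nu K L) :
  let Ksep := separable_closure K in
  let Gr := ramification_group nu K in
  let H := gal_over Ksep K L in
  let F := fixed_field (commutator_subgroup Gr H) in
  ~ linearly_disjoint K L F ->
  ~ artin_schreier_closed p (residue_subfield nu K) ->
  exists W1 W2 : set Kac,
    [/\ maximal_purely_wild p nu K W1, maximal_purely_wild p nu K W2 &
        ~ valued_isomorphic nu K W1 W2].
Proof.
move=> Ksep Gr H F notdisj notclosed.
have [c [Lc Kc Lsc]] := normal_element K_field Kac_alg K_hens char_p L_sep L_wild notdisj.
have [M [M_wild Mc]] := incompatible_purely_wild K_field Kac_alg K_hens char_p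
  L_wild notclosed (L_sep _ Lc) Kc Lsc.
have [W1 [W1max LW1]] := maximal_purely_wild_above K_field Kac_alg L_wild.
have [W2 [W2max MW2]] := maximal_purely_wild_above K_field Kac_alg M_wild.
exists W1, W2; split=> // -[f [[[fW1 _ _] fD fM fK] _]].
have [[W1_field KW1 _ _] _] := W1max; have W1_ring := subfield_subring W1_field.
have [W2_wild _] := W2max.
have K_ring := subfield_subring K_field.
have f1 : f 1 = 1 by apply: fK; exact: (subring1 K_ring).
have fN x : W1 x -> f (- x) = - f x.
  have KN1 : K (-1) by exact: (subringN K_ring (subring1 K_ring)).
  by move=> W1x; rewrite -mulN1r fM ?(fK _ KN1) ?mulN1r //; exact: KW1.
have [|s sf] := graph_extension K_field Kac_alg (S := [set (x, f x) | x in W1]).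
  split.
  - apply: subringP; split.
    + by exists 1; [exact: (subring1 W1_ring)|rewrite f1].
    + move=> _ _ [x xW <-] [y yW <-]; exists (x - y); first exact: (subringB W1_ring).
      by rewrite fD ?fN //; exact: (subringN W1_ring).
    + move=> _ _ [x xW <-] [y yW <-]; exists (x * y); first exact: (subringM W1_ring).
      by rewrite fM.
  - by move=> _ [x Kx <-]; exists x; [exact: KW1|rewrite fK].
  - move=> _ [x W1x <-] /= ->; apply: fK; exact: (subring0 K_ring).
apply: (Mc W2 W2_wild MW2) => u.
have W1u : W1 (gal_inv s (u c)) by apply: LW1; exact: (Lsc (gal_mul (gal_inv s) u)).
set x := gal_inv s (u c) in W1u.
have sx : s x = f x by apply: (sf (x, f x)); exists x.
have W2x : W2 (f x) by exact: fW1.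
by move: W2x; rewrite -sx [s x]gal_invK.
Qed.
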